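(* For $D\ge1$ let $\mathbb V(D):=\sup\{|u(0)|^2:\ u\in H^1_{\mathrm{per}}(0,2\pi),\ \int_0^{2\pi}u\,dx=0,\ \|u\|^2=1,\ \|u'\|^2=D\}$ and, for $\lambda>-1$, $G(\lambda):=\frac1{2\pi}\sum_{k\in\mathbb Z_0}\frac1{\lambda+k^2}$. Then for every fixed $D\ge1$ $$\mathbb V(D)=\min_{\lambda\in[-1,\infty)}(\lambda+D)G(\lambda),$$ where $G(-1):=+\infty$.
   Context: Functions are complex-valued and $2\pi$-periodic; $\|\cdot\|$ is the $L_2(0,2\pi)$ norm; $\mathbb Z_0=\mathbb Z\setminus\{0\}$.
   Formalization: At λ = -1 the value of (λ+D)G(λ) is taken to be its limit as λ → -1 from the right: +∞ for D > 1, as in the text, and 1/π for D = 1, where the product 0·(+∞) with G(-1) = +∞ is undefined and no value but the limit 1/π makes the claim true. *)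

(* Defs.v *)
From HB Require Import structures.
From mathcomp Require Import all_boot all_order all_algebra.
From mathcomp Require Import all_classical all_reals all_analysis.
Set Implicit Arguments. Unset Strict Implicit. Unset Printing Implicit Defensive.
Import Order.TTheory GRing.Theory Num.Theory.
Import numFieldNormedType.Exports.
Local Open Scope classical_set_scope.
Local Open Scope ring_scope.

Section Defs.
Variable R : realType.
Local Notation leb := (@lebesgue_measure R).

(* A complex-valued function u = ur + i ui : R -> C is encoded by its real
   and imaginary parts.  [H1per ur ui gr gi] : u is 2pi-periodic and
   u(x) = u(0) + int_0^x g on [0,2pi] with g = gr + i gi in L2(0,2pi);
   i.e. u is (the continuous representative of) an element of H^1_per(0,2pi)
   with weak derivative u' = g. *)
Definition L2_0_2pi (g : R -> R) : Prop :=
  measurable_fun `[0, 2 * pi] g /\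
  leb.-integrable `[0, 2 * pi] (fun x => (g x ^+ 2)%:E).

Definition H1per (ur ui gr gi : R -> R) : Prop :=
  (forall x, ur (x + 2 * pi) = ur x /\ ui (x + 2 * pi) = ui x) /\
  L2_0_2pi gr /\ L2_0_2pi gi /\
  (forall x, 0 <= x <= 2 * pi ->
     ur x = ur 0 + \int[leb]_(t in `[0, x]) gr t /\
     ui x = ui 0 + \int[leb]_(t in `[0, x]) gi t).

Definition admissible (D : R) (ur ui : R -> R) : Prop :=
  exists gr gi : R -> R,
    H1per ur ui gr gi /\
    \int[leb]_(x in `[0, 2 * pi]) ur x = 0 /\
    \int[leb]_(x in `[0, 2 * pi]) ui x = 0 /\
    \int[leb]_(x in `[0, 2 * pi]) (ur x ^+ 2 + ui x ^+ 2) = 1 /\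
    \int[leb]_(x in `[0, 2 * pi]) (gr x ^+ 2 + gi x ^+ 2) = D.

Definition VV (D : R) : \bar R :=
  ereal_sup [set y | exists ur ui, admissible D ur ui /\
                                   y = (ur 0 ^+ 2 + ui 0 ^+ 2)%:E].

(* G(lambda) = 1/(2pi) sum_{k in Z \ {0}} 1/(lambda + k^2)
             = 1/(2pi) * 2 * sum_{n >= 1} 1/(lambda + n^2)   (lambda > -1) *)
Definition G (l : R) : R :=
  (2 * pi)^-1 * (2 * limn (fun N => \sum_(1 <= n < N) (l + (n%:R) ^+ 2)^-1)).

(* Phi(lambda) = (lambda + D) G(lambda) for lambda > -1; at lambda = -1
   (where G(-1) = +oo) the value is the limit as lambda -> -1+
   (= +oo for D > 1). *)
Definition Phi (D l : R) : \bar R :=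
  if l == -1 then lim ((fun m : R => ((m + D) * G m)%:E) @ (-1)^'+)
  else ((l + D) * G l)%:E.

End Defs.

(* Main.v *)
(* For mean-zero u with Fourier coefficients c_k, Cauchy-Schwarz in the weight
   l + k^2 gives |u(0)|^2 = |sum c_k|^2 <= (|u'|^2 + l |u|^2) G(l) for every
   l > -1. For l < 0 this uses Parseval's equality for u, and in all cases the
   convergence of the Fourier series of u at 0; both follow from
   2 pi u(x) = int u'(t) s(t - x) dt, where s is the sawtooth, because the L2
   distance of s to its Fourier sums is a tail of sum 1/k^2 = pi^2/6.
   Conversely, if a truncated sum satisfies
   sum_(k <= n) (k^2 - D)/(l + k^2)^2 = 0, then the trigonometric polynomial with
   coefficients proportional to 1/(l + k^2) is admissible and attains
   (l + D) G_n(l), G_n being the truncation of G. For D > 1 such roots l_n exist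
   in a fixed compact interval of (-1, oo), where G_n -> G uniformly, so the
   supremum equals the minimum of the continuous function (l + D) G(l) there.
   For D = 1 the minimum is the limit 1/pi at l = -1, attained by cos. *)
Require Import Defs.
From HB Require Import structures.
From mathcomp Require Import all_boot all_order all_algebra.
From mathcomp Require Import all_classical all_reals all_analysis.
From mathcomp Require Import measurable_realfun ring lra.
Import Order.TTheory GRing.Theory Num.Theory.
Import numFieldNormedType.Exports.
Local Open Scope classical_set_scope.
Local Open Scope ring_scope.

(** Every limit is taken over finite sums with explicit errors, and each error is a constant times
    [basel_tail n], both for the Fourier sums and for the truncations of [G]. The condition imposed
    on the truncated sum is not ad hoc. Since the derivative of (l + D) / (l + k^2) in l is (k^2 -
    D) / (l + k^2)^2, it says that l is a critical point of (l + D) G_n(l). Among polynomials of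
    degree n, the Cauchy-Schwarz bound at such an l is then met with equality. The critical points
    l_n are not tracked as n grows. If l0 minimises (l + D) G(l) on the compact interval, the value
    at l_n is at least the value at l0, and only the truncation error, uniform on the interval, has
    to vanish. That l0 is also a minimum over the whole half-line then follows from the upper bound,
    valid at each l. *)

(** * Calculus on a segment *)

Section Calculus.
Context {R : realType}.
Local Notation mu := (@lebesgue_measure R).
Implicit Types (f F h : R -> R) (a b : R).

Lemma is_derive_continuous f df :
  (forall x, is_derive x (1 : R) f (df x)) -> continuous f.
Proof.
move=> fdf x; apply/differentiable_continuous/derivable1_diffP.
exact: (@ex_derive _ _ _ _ _ _ _ (fdf x)).
Qed.

Lemma continuous_segment_integrable f a b :
  continuous f -> mu.-integrable `[a, b] (EFin \o f).
Proof.
move=> cf; apply: continuous_compact_integrable; first exact: segment_compact.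
exact: continuous_subspaceT.
Qed.

(** The antiderivatives used below are explicit and differentiable on the whole line, so
    differentiability everywhere replaces the one-sided conditions of [continuous_FTC2] at the
    endpoints. *)
Lemma Rintegral_FTC F f a b : a <= b ->
  (forall x, is_derive x (1 : R) F (f x)) -> continuous f ->
  \int[mu]_(x in `[a, b]) f x = F b - F a.
Proof.
rewrite le_eqVlt => /predU1P[<- _ _|ab Ff cf].
  by rewrite set_itv1 Rintegral_set1 subrr.
have cF := is_derive_continuous _ _ Ff.
rewrite /Rintegral (@continuous_FTC2 _ f F)//.
- exact: continuous_subspaceT.
- split.
  + by move=> x _; apply: (@ex_derive _ _ _ _ _ _ _ (Ff x)).
  + exact/cvg_at_right_filter/cF.
  + exact/cvg_at_left_filter/cF.
- by move=> x _; rewrite derive1E; apply: (@derive_val _ _ _ _ _ _ _ (Ff x)).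
Qed.

Lemma is_derive_mull (c x : R) : is_derive x (1 : R) ( *%R c) c.
Proof.
have := @is_deriveZ R R R id c x 1 1 _.
by rewrite /GRing.scale/= mulr1; apply.
Qed.

Lemma is_derive_sinM (c x : R) :
  is_derive x (1 : R) (fun t => sin (c * t)) (c * cos (c * x)).
Proof.
have d := is_derive_mull c x.
apply: (is_derive_eq (@is_derive1_comp R (@sin R) ( *%R c) x (cos (c * x)) c _ d)); ring.
Qed.

Lemma is_derive_cosM (c x : R) :
  is_derive x (1 : R) (fun t => cos (c * t)) (- (c * sin (c * x))).
Proof.
have d := is_derive_mull c x.
apply: (is_derive_eq (@is_derive1_comp R (@cos R) ( *%R c) x (- sin (c * x)) c _ d)); ring.
Qed.

Lemma continuous_sinM (c : R) : continuous (fun t => sin (c * t)).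
Proof. exact: is_derive_continuous (is_derive_sinM c). Qed.

Lemma continuous_cosM (c : R) : continuous (fun t => cos (c * t)).
Proof. exact: is_derive_continuous (is_derive_cosM c). Qed.

Lemma integrableM_continuous f h a b :
  mu.-integrable `[a, b] (EFin \o f) -> continuous h ->
  mu.-integrable `[a, b] (EFin \o (fun x => f x * h x)).
Proof.
move=> fi ch; apply: (integrableMl _ fi) => //.
  by apply: measurable_funTS; exact: continuous_measurable_fun.
have /compact_bounded[M [_ Mh]] := continuous_compact
  (@continuous_subspaceT _ _ `[a, b] _ ch) (@segment_compact _ a b).
by exists M; split; rewrite ?num_real // => ? ? ? ?; exact: Mh.
Qed.

Lemma integrableZ_EFin f a b c : mu.-integrable `[a, b] (EFin \o f) ->
  mu.-integrable `[a, b] (EFin \o (fun x => c * f x)).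
Proof. by move=> fi; exact: (integrableZl _ c fi). Qed.

Lemma integrableD_EFin f h a b : mu.-integrable `[a, b] (EFin \o f) ->
  mu.-integrable `[a, b] (EFin \o h) ->
  mu.-integrable `[a, b] (EFin \o (fun x => f x + h x)).
Proof. by move=> fi hi; exact: (integrableD _ fi hi). Qed.

Lemma integrableB_EFin f h a b : mu.-integrable `[a, b] (EFin \o f) ->
  mu.-integrable `[a, b] (EFin \o h) ->
  mu.-integrable `[a, b] (EFin \o (fun x => f x - h x)).
Proof. by move=> fi hi; exact: (integrableB _ fi hi). Qed.

Lemma Rintegral_sum (F : nat -> R -> R) n a b :
  (forall k, mu.-integrable `[a, b] (EFin \o F k)) ->
  mu.-integrable `[a, b] (EFin \o (fun x => \sum_(k < n) F k x)) /\
  \int[mu]_(x in `[a, b]) \sum_(k < n) F k x =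
  \sum_(k < n) \int[mu]_(x in `[a, b]) F k x.
Proof.
move=> Fi; elim: n => [|n [IHi IH]].
  have -> : (fun x => \sum_(k < 0) F k x) = cst 0.
    by apply/funext => x; rewrite big_ord0.
  split; first by apply: continuous_segment_integrable; exact: cst_continuous.
  by rewrite big_ord0 Rintegral_cst// mul0r.
have -> : (fun x => \sum_(k < n.+1) F k x) = fun x => \sum_(k < n) F k x + F n x.
  by apply/funext => x; rewrite big_ord_recr.
split; first exact: integrableD_EFin.
by rewrite big_ord_recr/= RintegralD// IH.
Qed.

End Calculus.

(** * Trigonometric polynomials *)

Section TrigPoly.
Context {R : realType}.
Local Notation mu := (@lebesgue_measure R).
Implicit Types (al be : nat -> R) (f : R -> R).

(* The coefficient of index k belongs to the frequency k + 1, so the mean is 0. *)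
Definition trigpoly al be n (x : R) : R :=
  \sum_(k < n) (al k * cos (k.+1%:R * x) + be k * sin (k.+1%:R * x)).

Lemma is_derive_trigpoly al be n (x : R) :
  is_derive x (1 : R) (trigpoly al be n)
    (trigpoly (fun k => k.+1%:R * be k) (fun k => - (k.+1%:R * al k)) n x).
Proof.
elim: n => [|n IH].
  rewrite (_ : trigpoly al be 0 = cst 0).
    by rewrite /trigpoly big_ord0; exact: is_derive_cst.
  by apply/funext => y; rewrite /trigpoly big_ord0.
rewrite (_ : trigpoly al be n.+1 = trigpoly al be n +
  (al n *: (fun t => cos (n.+1%:R * t)) + be n *: (fun t => sin (n.+1%:R * t)))).
  have dc := @is_deriveZ _ _ _ _ (al n) _ _ _ (is_derive_cosM n.+1%:R x).
  have ds := @is_deriveZ _ _ _ _ (be n) _ _ _ (is_derive_sinM n.+1%:R x).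
  apply: (is_derive_eq (is_deriveD IH (is_deriveD dc ds))).
  rewrite [in RHS]/trigpoly big_ord_recr/= /GRing.scale/=; congr (_ + _); ring.
by apply/funext => y; rewrite /trigpoly big_ord_recr.
Qed.

Lemma continuous_trigpoly al be n : continuous (trigpoly al be n).
Proof. exact: is_derive_continuous (is_derive_trigpoly al be n). Qed.

End TrigPoly.

(** * Fourier coefficients on a period *)

Section Orthogonality.
Context {R : realType}.
Local Notation mu := (@lebesgue_measure R).
Local Notation I := (`[0%R, 2 * pi]%classic : set R).
Implicit Types (al be : nat -> R) (f : R -> R).

Lemma period_ge0 : 0 <= 2 * pi :> R.
Proof. by rewrite mulr_ge0// pi_ge0. Qed.

Lemma nat_period k : k%:R * (2 * pi) = pi *+ 2 *+ k :> R.
Proof. by rewrite -[RHS]mulr_natl -(mulr_natl pi). Qed.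

Lemma sin_nat_period k : sin (k%:R * (2 * pi)) = 0 :> R.
Proof. by rewrite nat_period -[_ *+ k]add0r (periodicn (@sinD2pi R)) sin0. Qed.

Lemma cos_nat_period k : cos (k%:R * (2 * pi)) = 1 :> R.
Proof. by rewrite nat_period -[_ *+ k]add0r (periodicn (@cosD2pi R)) cos0. Qed.

Lemma Rintegral_cosM (c : R) : c != 0 -> sin (c * (2 * pi)) = 0 ->
  \int[mu]_(x in I) cos (c * x) = 0.
Proof.
move=> c0 sc.
have d (x : R) : is_derive x (1 : R) (fun x => c^-1 * sin (c * x)) (cos (c * x)).
  apply: (is_derive_eq (@is_deriveZ _ _ _ _ c^-1 _ _ _ (is_derive_sinM c x))).
  by rewrite /GRing.scale/= mulKf.
rewrite (Rintegral_FTC (fun x => c^-1 * sin (c * x)))//=.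
- by rewrite sc !mulr0 sin0 mulr0 subr0.
- exact: period_ge0.
- exact: continuous_cosM.
Qed.

Lemma Rintegral_sinM (c : R) : cos (c * (2 * pi)) = 1 ->
  \int[mu]_(x in I) sin (c * x) = 0.
Proof.
have [->|c0] := eqVneq c 0 => cc.
  under eq_Rintegral do rewrite mul0r sin0.
  by rewrite Rintegral_cst// mul0r.
have d (x : R) : is_derive x (1 : R) (fun x => - c^-1 * cos (c * x)) (sin (c * x)).
  apply: (is_derive_eq (@is_deriveZ _ _ _ _ (- c^-1) _ _ _ (is_derive_cosM c x))).
  by rewrite /GRing.scale/= mulrNN mulKf.
rewrite (Rintegral_FTC (fun x => - c^-1 * cos (c * x)))//=.
- by rewrite cc mulr0 cos0 subrr.
- exact: period_ge0.
- exact: continuous_sinM.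
Qed.

Lemma Rintegral_const (c : R) : \int[mu]_(x in I) c = c * (2 * pi).
Proof.
have d x := is_derive_mull c x.
rewrite (Rintegral_FTC ( *%R c)) ?mulr0 ?subr0//.
- exact: period_ge0.
- exact: cst_continuous.
Qed.

Lemma Rintegral_half_sum f h : continuous f -> continuous h ->
  \int[mu]_(x in I) (2^-1 * (f x + h x)) =
  2^-1 * (\int[mu]_(x in I) f x + \int[mu]_(x in I) h x).
Proof.
move=> cf ch.
have ? := continuous_segment_integrable _ 0 (2 * pi) cf.
have ? := continuous_segment_integrable _ 0 (2 * pi) ch.
by rewrite RintegralZl ?RintegralD//; exact: integrableD_EFin.
Qed.

Lemma freqD i j : i.+1%:R + j.+1%:R != 0 :> R.
Proof. by rewrite -natrD pnatr_eq0. Qed.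

Lemma freqB i j : i != j -> i.+1%:R - j.+1%:R != 0 :> R.
Proof. by rewrite subr_eq0 eqr_nat eqSS. Qed.

Lemma sin_freqD i j : sin ((i%:R + j%:R) * (2 * pi)) = 0 :> R.
Proof. by rewrite -natrD sin_nat_period. Qed.

Lemma sin_freqB i j : sin ((i%:R - j%:R) * (2 * pi)) = 0 :> R.
Proof. by rewrite mulrBl sinB !sin_nat_period mul0r mulr0 subr0. Qed.

Lemma cos_freqD i j : cos ((i%:R + j%:R) * (2 * pi)) = 1 :> R.
Proof. by rewrite -natrD cos_nat_period. Qed.

Lemma cos_freqB i j : cos ((i%:R - j%:R) * (2 * pi)) = 1 :> R.
Proof.
by rewrite mulrBl cosB !sin_nat_period !cos_nat_period mulr0 addr0 mulr1.
Qed.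

Lemma Rintegral_cos_cos i j :
  \int[mu]_(x in I) (cos (i.+1%:R * x) * cos (j.+1%:R * x)) =
  if i == j then pi else 0.
Proof.
have E x : cos (i.+1%:R * x) * cos (j.+1%:R * x) =
    2^-1 * (cos ((i.+1%:R - j.+1%:R) * x) + cos ((i.+1%:R + j.+1%:R) * x)) :> R.
  by rewrite mulrBl mulrDl cosB cosD; field.
under eq_Rintegral do rewrite E.
rewrite Rintegral_half_sum; try exact: continuous_cosM.
rewrite [X in _ * (_ + X)]Rintegral_cosM ?sin_freqD ?freqD// addr0.
have [->|ij] := eqVneq i j; last first.
  by rewrite Rintegral_cosM ?sin_freqB ?freqB// mulr0.
under eq_Rintegral do rewrite subrr mul0r cos0.
by rewrite Rintegral_const; field.
Qed.

Lemma Rintegral_sin_sin i j :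
  \int[mu]_(x in I) (sin (i.+1%:R * x) * sin (j.+1%:R * x)) =
  if i == j then pi else 0.
Proof.
(* Written with cos * cos rather than cos (a + b), so that [Rintegral_cos_cos] can be reused. *)
have E x : sin (i.+1%:R * x) * sin (j.+1%:R * x) =
    cos ((i.+1%:R - j.+1%:R) * x) - cos (i.+1%:R * x) * cos (j.+1%:R * x) :> R.
  by rewrite mulrBl cosB; ring.
have cc (k : nat) := continuous_cosM (k%:R : R).
have ci := continuous_segment_integrable _ 0 (2 * pi) (cc i.+1).
under eq_Rintegral do rewrite E.
rewrite RintegralB//; last 2 first.
- exact/continuous_segment_integrable/continuous_cosM.
- exact: integrableM_continuous.
rewrite Rintegral_cos_cos; have [->|ij] := eqVneq i j; last first.
  by rewrite Rintegral_cosM ?sin_freqB ?freqB// subr0.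
under eq_Rintegral do rewrite subrr mul0r cos0.
by rewrite Rintegral_const; ring.
Qed.

Lemma Rintegral_sin_cos i j :
  \int[mu]_(x in I) (sin (i.+1%:R * x) * cos (j.+1%:R * x)) = 0 :> R.
Proof.
have E x : sin (i.+1%:R * x) * cos (j.+1%:R * x) =
    2^-1 * (sin ((i.+1%:R - j.+1%:R) * x) + sin ((i.+1%:R + j.+1%:R) * x)) :> R.
  by rewrite mulrBl mulrDl sinB sinD; field.
under eq_Rintegral do rewrite E.
rewrite Rintegral_half_sum; try exact: continuous_sinM.
by rewrite !Rintegral_sinM ?cos_freqB ?cos_freqD// addr0 mulr0.
Qed.

(** Not normalised: the Fourier coefficient of frequency k + 1 is [pi^-1 * fcos f k]. *)
Definition fcos f k : R := \int[mu]_(x in I) (f x * cos (k.+1%:R * x)).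
Definition fsin f k : R := \int[mu]_(x in I) (f x * sin (k.+1%:R * x)).

Lemma Rintegral_mul_trigpoly f al be n : mu.-integrable I (EFin \o f) ->
  \int[mu]_(x in I) (f x * trigpoly al be n x) =
  \sum_(k < n) (al k * fcos f k + be k * fsin f k).
Proof.
move=> fi.
have ic k := integrableM_continuous _ _ _ _ fi (continuous_cosM (k.+1%:R : R)).
have isn k := integrableM_continuous _ _ _ _ fi (continuous_sinM (k.+1%:R : R)).
pose F k x := al k * (f x * cos (k.+1%:R * x)) + be k * (f x * sin (k.+1%:R * x)).
have E x : f x * trigpoly al be n x = \sum_(k < n) F k x.
  by rewrite /trigpoly big_distrr/=; apply: eq_bigr => k _; rewrite /F; ring.
under eq_Rintegral do rewrite E.
rewrite (proj2 (Rintegral_sum F n _ _ _)).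
  apply: eq_bigr => k _; rewrite RintegralD ?RintegralZl//;
  exact: integrableZ_EFin.
by move=> k; apply: integrableD_EFin; exact: integrableZ_EFin.
Qed.

Lemma sum_delta al n (k : 'I_n) :
  \sum_(i < n) al i * (if k == i :> nat then pi else 0) = pi * al k.
Proof.
rewrite (bigD1 k)//= eqxx big1 ?addr0 1?mulrC// => i ik.
by rewrite eq_sym ifN ?mulr0.
Qed.

Lemma fcos_trigpoly al be n (k : 'I_n) : fcos (trigpoly al be n) k = pi * al k.
Proof.
rewrite /fcos; under eq_Rintegral do rewrite mulrC.
rewrite Rintegral_mul_trigpoly; last first.
  exact/continuous_segment_integrable/continuous_cosM.
rewrite -[RHS]sum_delta; apply: eq_bigr => i _.
rewrite /fcos Rintegral_cos_cos /fsin; under eq_Rintegral do rewrite mulrC.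
by rewrite Rintegral_sin_cos mulr0 addr0.
Qed.

Lemma fsin_trigpoly al be n (k : 'I_n) : fsin (trigpoly al be n) k = pi * be k.
Proof.
rewrite /fsin; under eq_Rintegral do rewrite mulrC.
rewrite Rintegral_mul_trigpoly; last first.
  exact/continuous_segment_integrable/continuous_sinM.
rewrite -[RHS]sum_delta; apply: eq_bigr => i _.
by rewrite /fsin Rintegral_sin_sin /fcos Rintegral_sin_cos mulr0 add0r.
Qed.

Lemma Rintegral_trigpoly_sq al be n :
  \int[mu]_(x in I) (trigpoly al be n x ^+ 2) =
  pi * \sum_(k < n) (al k ^+ 2 + be k ^+ 2).
Proof.
under eq_Rintegral do rewrite expr2.
rewrite Rintegral_mul_trigpoly; last first.
  exact/continuous_segment_integrable/continuous_trigpoly.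
rewrite big_distrr/=; apply: eq_bigr => k _.
by rewrite fcos_trigpoly fsin_trigpoly; ring.
Qed.

Lemma Rintegral_trigpoly al be n : \int[mu]_(x in I) trigpoly al be n x = 0.
Proof.
under eq_Rintegral do rewrite -[trigpoly _ _ _ _]mul1r.
rewrite (Rintegral_mul_trigpoly (fun=> 1)); last first.
  exact/continuous_segment_integrable/cst_continuous.
rewrite big1// => k _; rewrite /fcos /fsin.
under eq_Rintegral do rewrite mul1r.
rewrite Rintegral_cosM ?sin_nat_period ?pnatr_eq0//.
under eq_Rintegral do rewrite mul1r.
by rewrite Rintegral_sinM ?cos_nat_period//; ring.
Qed.

Lemma Rintegral_sqB_trigpoly f al be n :
  mu.-integrable I (EFin \o f) -> mu.-integrable I (EFin \o (fun x => f x ^+ 2)) ->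
  \int[mu]_(x in I) ((f x - trigpoly al be n x) ^+ 2) =
  \int[mu]_(x in I) (f x ^+ 2)
  - 2 * \sum_(k < n) (al k * fcos f k + be k * fsin f k)
  + pi * \sum_(k < n) (al k ^+ 2 + be k ^+ 2).
Proof.
move=> fi f2i; have ct := continuous_trigpoly al be n.
have E x : (f x - trigpoly al be n x) ^+ 2 = f x ^+ 2
    - 2 * (f x * trigpoly al be n x) + trigpoly al be n x ^+ 2 by ring.
have i1 := integrableZ_EFin _ _ _ 2 (integrableM_continuous _ _ _ _ fi ct).
under eq_Rintegral do rewrite E.
rewrite RintegralD ?RintegralB ?RintegralZl ?(Rintegral_mul_trigpoly f)//.
- by rewrite Rintegral_trigpoly_sq.
- exact: integrableM_continuous.
- exact: integrableB_EFin.
- by apply: continuous_segment_integrable => x; apply: continuousM; exact: ct.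
Qed.

(** With the Fourier coefficients the cross term is minus twice the quadratic one, which leaves the
    defect in Bessel's inequality. Its sign gives [Bessel], and an upper bound for it gives
    [Parseval_le]. *)
Lemma Rintegral_sqB_Fourier f n :
  mu.-integrable I (EFin \o f) -> mu.-integrable I (EFin \o (fun x => f x ^+ 2)) ->
  \int[mu]_(x in I)
    ((f x - trigpoly (fun k => pi^-1 * fcos f k) (fun k => pi^-1 * fsin f k) n x) ^+ 2) =
  \int[mu]_(x in I) (f x ^+ 2) - pi^-1 * \sum_(k < n) (fcos f k ^+ 2 + fsin f k ^+ 2).
Proof.
move=> fi f2i; rewrite Rintegral_sqB_trigpoly// -addrA; congr (_ + _).
rewrite !big_distrr -sumrN -big_split -sumrN/=; apply: eq_bigr => k _.
have := lt0r_neq0 (pi_gt0 R).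
by move: (pi) (fcos f k) (fsin f k) => p a b p0; field.
Qed.

End Orthogonality.

(** * The Basel problem *)

Section Basel.
Context {R : realType}.
Local Notation mu := (@lebesgue_measure R).
Local Notation I := (`[0%R, pi / 2]%classic : set R).

Definition wallis n : R := \int[mu]_(x in I) (cos x ^+ (2 * n)).
Definition wallis2 n : R := \int[mu]_(x in I) (x ^+ 2 * cos x ^+ (2 * n)).

Lemma continuous_cosX n : continuous (fun x : R => cos x ^+ n).
Proof.
move=> x; apply: (@continuous_comp _ _ _ cos (fun y : R => y ^+ n)).
  exact: continuous_cos.
exact: exprn_continuous.
Qed.

Lemma is_derive_cosX n (x : R) : is_derive x (1 : R) (fun t => cos t ^+ n.+1)
  (- (n.+1%:R * cos x ^+ n * sin x)).
Proof.
have -> : (fun t : R => cos t ^+ n.+1) = cos ^+ n.+1 by rewrite exprfctE.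
apply: (is_derive_eq (@is_deriveX _ _ _ n.+1 _ _ _ (is_derive_cos x))).
by rewrite /GRing.scale/= mulrN.
Qed.

(** The difference of the two sides is the integral of the derivative of
    [sin x * cos x ^+ (2 * n).+1], which vanishes at 0 and at [pi / 2]. *)
Lemma wallis_rec n :
  (2 * n%:R + 2) * wallis n.+1 = (2 * n%:R + 1) * wallis n.
Proof.
pose f (x : R) := (2 * n%:R + 2) * cos x ^+ (2 * n.+1) - (2 * n%:R + 1) * cos x ^+ (2 * n).
have d (x : R) : is_derive x (1 : R) (fun x => sin x * cos x ^+ (2 * n).+1) (f x).
  apply: (is_derive_eq (is_deriveM (is_derive_sin x) (is_derive_cosX (2 * n) x))).
  rewrite /f /GRing.scale/= mulnS addnC addn2 !exprS -[in (2 * n).+1%:R]addn1 natrD natrM.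
  have := sin2cos2 x; move: (cos x ^+ (2 * n)) (sin x) (cos x) => p s c e.
  ring: e.
have cX k := continuous_cosX k.
have ci k := continuous_segment_integrable _ 0 (pi / 2) (cX k).
apply/eqP; rewrite -subr_eq0 -!RintegralZl// -RintegralB//; last 2 first.
- exact: integrableZ_EFin.
- exact: integrableZ_EFin.
rewrite (Rintegral_FTC (fun x => sin x * cos x ^+ (2 * n).+1)).
- by rewrite cos_pihalf sin0 exprS !mul0r mulr0 subrr.
- by rewrite divr_ge0// pi_ge0.
- by move=> x; apply: cvgB; apply: cvgZr; exact: cX.
Qed.

Lemma wallis2_rec n :
  wallis n.+1 + 2 * (n%:R + 1) ^+ 2 * wallis2 n.+1 =
  (n%:R + 1) * (2 * n%:R + 1) * wallis2 n.
Proof.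
(* Two integrations by parts in one antiderivative: the first summand cancels the terms in
   [x * sin x * cos x ^+ (2 * n).+1] that the second produces. F vanishes at both endpoints. *)
pose F (x : R) := x * cos x ^+ (2 * n).+2
  + (n%:R + 1) * (x ^+ 2 * (sin x * cos x ^+ (2 * n).+1)).
pose f (x : R) := cos x ^+ (2 * n.+1)
  + 2 * (n%:R + 1) ^+ 2 * (x ^+ 2 * cos x ^+ (2 * n.+1))
  - (n%:R + 1) * (2 * n%:R + 1) * (x ^+ 2 * cos x ^+ (2 * n)).
have d (x : R) : is_derive x (1 : R) F (f x).
  have d2 : is_derive x (1 : R) (fun x => x ^+ 2) (2 * x).
    have -> : (fun t : R => t ^+ 2) = id ^+ 2 by rewrite exprfctE.
    apply: (is_derive_eq (@is_deriveX _ _ _ 2 _ _ _ (is_derive_id x (1 : R)))).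
    by rewrite /GRing.scale/= mulr1 expr1.
  have ds : is_derive x (1 : R) (fun t => sin t * cos t ^+ (2 * n).+1) _ :=
    is_deriveM (is_derive_sin x) (is_derive_cosX (2 * n) x).
  have d1 := is_deriveM (is_derive_id x (1 : R)) (is_derive_cosX (2 * n).+1 x).
  apply: (is_derive_eq (is_deriveD d1 (@is_deriveZ _ _ _ _ (n%:R + 1) _ _ _ (is_deriveM d2 ds)))).
  rewrite /f /GRing.scale/= mulnS addnC addn2 !(exprS (cos x)).
  rewrite -[in (2 * n).+2%:R]addn2 -[in (2 * n).+1%:R]addn1 !(natrD _ (2 * n)) natrM.
  have := sin2cos2 x; move: (cos x ^+ (2 * n)) (sin x) (cos x) => p s c e.
  ring: e.
have cX k := continuous_cosX k.
have c2X k : continuous (fun x : R => x ^+ 2 * cos x ^+ k).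
  by move=> x; apply: cvgM; [exact: exprn_continuous|exact: cX].
have ci k := continuous_segment_integrable _ 0 (pi / 2) (cX k).
have c2i k := continuous_segment_integrable _ 0 (pi / 2) (c2X k).
apply/eqP; rewrite -subr_eq0 -!RintegralZl// -RintegralD//; last exact: integrableZ_EFin.
rewrite -RintegralB//; last 2 first.
- by apply: integrableD_EFin => //; exact: integrableZ_EFin.
- exact: integrableZ_EFin.
rewrite (Rintegral_FTC F).
- by rewrite /F cos_pihalf sin0 !exprS !mul0r !mulr0 addr0 subrr.
- by rewrite divr_ge0// pi_ge0.
- move=> x; apply: cvgB; last by apply: cvgZr; exact: c2X.
  by apply: cvgD; [exact: cX|apply: cvgZr; exact: c2X].
Qed.

(** This is x <= tan x without the division. It holds because sin y - y cos y has the nonnegative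
    derivative y sin y; squared, it yields [wallis2_le]. *)
Lemma sin_ge_mul_cos (x : R) : 0 <= x <= pi / 2 -> 0 <= x * cos x <= sin x.
Proof.
move=> /andP[x0 xh]; apply/andP; split.
  by rewrite mulr_ge0// cos_ge0_pihalf// xh (le_trans _ x0)// oppr_le0 divr_ge0// pi_ge0.
pose f (y : R) := sin y - y * cos y.
have d (y : R) : is_derive y (1 : R) f (y * sin y).
  apply: (is_derive_eq (is_deriveB (is_derive_sin y)
    (is_deriveM (is_derive_id y (1 : R)) (is_derive_cos y)))).
  by rewrite /GRing.scale/=; ring.
have cf := is_derive_continuous _ _ d.
suff: f 0 <= f x by rewrite /f sin0 mul0r subrr subr_ge0.
apply: (@ger0_derive1_le_cc _ f 0 (pi / 2)) => //.
- move=> y; rewrite in_itv/= => /andP[/ltW y0 /ltW yh].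
  rewrite derive1E (@derive_val _ _ _ _ _ _ _ (d y)) mulr_ge0//.
  by rewrite sin_ge0_pi// y0/= (le_trans yh)// ler_pdivrMr// ler_peMr ?pi_ge0// ler1n.
- exact: continuous_subspaceT.
- by rewrite in_itv/= lexx divr_ge0// pi_ge0.
- by rewrite in_itv/= x0.
Qed.

Lemma wallis_gt0 n : 0 < wallis n.
Proof.
elim: n => [|n IH].
  rewrite /wallis; under eq_Rintegral do rewrite muln0 expr0.
  rewrite (Rintegral_FTC id)//; last exact: cst_continuous.
    by rewrite subr0 divr_gt0 ?pi_gt0.
  by rewrite divr_ge0// pi_ge0.
have n0 : 0 <= n%:R :> R by rewrite ler0n.
have : 0 < (2 * n%:R + 2) * wallis n.+1.
  by rewrite wallis_rec mulr_gt0//; lra.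
by rewrite pmulr_rgt0//; lra.
Qed.

Lemma wallis2_ge0 n : 0 <= wallis2 n.
Proof.
apply: Rintegral_ge0 => x _; rewrite mulr_ge0 ?sqr_ge0//.
by rewrite exprM exprn_ge0// sqr_ge0.
Qed.

(** From x^2 cos^2 x <= sin^2 x, the integrand of [wallis2 n.+1] is at most cos^(2n) x - cos^(2n+2)
    x, and by [wallis_rec] the integral of that is [wallis n.+1 / (2 * n%:R + 1)]. *)
Lemma wallis2_le n : (2 * n%:R + 1) * wallis2 n.+1 <= wallis n.+1.
Proof.
have cX k := continuous_cosX k.
have ci k := continuous_segment_integrable _ 0 (pi / 2) (cX k).
have c2X k : continuous (fun x : R => x ^+ 2 * cos x ^+ k).
  by move=> x; apply: cvgM; [exact: exprn_continuous|exact: cX].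
have c2i k := continuous_segment_integrable _ 0 (pi / 2) (c2X k).
have : wallis2 n.+1 <= wallis n - wallis n.+1.
  rewrite -RintegralB//; apply: le_Rintegral => //.
    exact: integrableB_EFin.
  move=> x /=; rewrite in_itv/= => /sin_ge_mul_cos/andP[xc0 xcs].
  rewrite mulnS addnC exprD mulrCA -exprMn -[X in _ <= X - _]mulr1 -mulrBr -sin2cos2.
  rewrite exprM; apply: ler_wpM2l; first exact/exprn_ge0/sqr_ge0.
  by rewrite ler_sqr ?nnegrE// (le_trans xc0).
have := wallis_rec n; have := wallis_gt0 n.+1; have := wallis2_ge0 n.+1.
have : 0 <= n%:R :> R by rewrite ler0n.
nra.
Qed.

(* Matsuoka's argument: wallis2 n / wallis n decreases by 1 / (2 (n + 1)^2) at each
   step and tends to 0. *)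
Lemma basel_wallis n :
  \sum_(k < n) (k.+1%:R ^+ 2)^-1 = pi ^+ 2 / 6 - 2 * (wallis2 n / wallis n).
Proof.
elim: n => [|n IH].
  (* For n = 0 the ratio is [pi ^+ 2 / 12]; the constant [pi ^+ 2 / 6] comes from here. *)
  have d (x : R) : is_derive x (1 : R) (fun t => 3^-1 * t ^+ 3) (x ^+ 2).
    have -> : (fun t : R => 3^-1 * t ^+ 3) = 3^-1 *: (id ^+ 3) by rewrite exprfctE.
    apply: (is_derive_eq (@is_deriveZ _ _ _ _ 3^-1 _ _ _
      (@is_deriveX _ _ _ 3 _ _ _ (is_derive_id x (1 : R))))).
    by rewrite /GRing.scale/=; field.
  have h0 : 0 <= pi / 2 :> R by rewrite divr_ge0// pi_ge0.
  rewrite big_ord0 /wallis /wallis2.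
  under eq_Rintegral do rewrite muln0 expr0 mulr1.
  rewrite (Rintegral_FTC (fun t => 3^-1 * t ^+ 3))//; last exact: exprn_continuous.
  under eq_Rintegral do rewrite muln0 expr0.
  rewrite (Rintegral_FTC id)//; last exact: cst_continuous.
  have := lt0r_neq0 (pi_gt0 R).
  by move: (pi) => p p0; field.
rewrite big_ord_recr/= IH.
have := wallis_rec n; have := wallis2_rec n.
have := lt0r_neq0 (wallis_gt0 n); have := lt0r_neq0 (wallis_gt0 n.+1).
rewrite -[n.+1%:R]natr1; have : 0 <= n%:R :> R by rewrite ler0n.
move: (wallis2 n) (wallis2 n.+1) (wallis n) (wallis n.+1) n%:R => a b c d e e0 d0 c0 h1 h2.
have e1 : e + 1 != 0 by rewrite lt0r_neq0//; lra.
have e2 : 2 * e + 1 != 0 by rewrite lt0r_neq0//; lra.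
have -> : a = (d + 2 * (e + 1) ^+ 2 * b) / ((e + 1) * (2 * e + 1)).
  by rewrite h1; field; rewrite e1 e2.
have -> : c = (2 * e + 2) * d / (2 * e + 1) by rewrite h2; field.
move: (pi ^+ 2) => p; have e3 : 2 * e + 2 != 0 by rewrite lt0r_neq0//; lra.
by field; rewrite ?e1 ?e2 ?e3 ?d0.
Qed.

(** The tail of the series of 1/k^2 beyond k = n, in closed form. By [basel_wallis] it equals twice
    a ratio of integrals, hence its sign and its decay. *)
Definition basel_tail n : R := pi ^+ 2 / 6 - \sum_(k < n) (k.+1%:R ^+ 2)^-1.

Lemma basel_tail_ge0 n : 0 <= basel_tail n.
Proof.
rewrite /basel_tail basel_wallis subKr mulr_ge0// divr_ge0 ?wallis2_ge0//.
exact/ltW/wallis_gt0.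
Qed.

Lemma basel_tail_le n : basel_tail n.+1 <= 2 / (2 * n%:R + 1).
Proof.
have n0 : 0 < 2 * n%:R + 1 :> R by rewrite ltr_wpDl// mulr_ge0.
rewrite /basel_tail basel_wallis subKr ler_wpM2l//.
rewrite ler_pdivrMr ?wallis_gt0// ler_pdivlMl//.
exact: wallis2_le.
Qed.

Lemma cvg_basel_tail : basel_tail n @[n --> \oo] --> 0.
Proof.
rewrite -cvg_shiftS/=; apply: (@squeeze_cvgr _ _ _ _ (cst 0) (fun n => 2 * n.+1%:R^-1)).
- apply: nearW => n; rewrite basel_tail_ge0/= (le_trans (basel_tail_le n))//.
  rewrite ler_wpM2l// lef_pV2 ?posrE ?ltr_wpDl ?mulr_ge0//.
  by rewrite -natr1 lerD2r ler_peMl// ler1n.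
- exact: cvg_cst.
- rewrite -[0](mulr0 2); apply: cvgMr; exact: cvg_harmonic.
Qed.

End Basel.

(** * Integration by parts for absolutely continuous functions *)

Section AbsolutelyContinuous.
Context {R : realType}.
Local Notation mu := (@lebesgue_measure R).
Implicit Types (u g h dh : R -> R) (T : R).

(** One real component of [H1per], with g in L1: the class in which integration by parts is
    proved. *)
Definition is_primitive T u g :=
  mu.-integrable `[0, T] (EFin \o g) /\
  forall x, 0 <= x <= T -> u x = u 0 + \int[mu]_(t in `[0, x]) g t.

Lemma continuous_within_primitive T u g : 0 <= T -> is_primitive T u g ->
  {within `[0, T], continuous u}.
Proof.
move=> T0 [gi uE].
have c := parameterized_integral_continuous T0 gi.
have : {within `[0, T], continuous (fun x => u 0 + parameterized_integral mu 0 x g)}.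
  apply/subspace_continuousP => x xI; apply: cvgD; first exact: cvg_cst.
  by move/subspace_continuousP : c; exact.
apply: subspace_eq_continuous => x.
by rewrite inE/= in_itv/= => /uE e; exact/esym/e.
Qed.

Lemma integrable_within f T : {within `[0, T], continuous f} ->
  mu.-integrable `[0, T] (EFin \o f).
Proof. by move=> cf; apply: continuous_compact_integrable; first exact: segment_compact. Qed.

Lemma integrable_primitive_mul T u g h : 0 <= T -> is_primitive T u g ->
  continuous h -> mu.-integrable `[0, T] (EFin \o (fun x => u x * h x)).
Proof.
move=> T0 ug ch; apply: integrableM_continuous => //.
exact/integrable_within/(continuous_within_primitive _ _ _ T0 ug).
Qed.

Lemma integrable_primitive_sq T u g : 0 <= T -> is_primitive T u g ->
  mu.-integrable `[0, T] (EFin \o (fun x => u x ^+ 2)).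
Proof.
move=> T0 ug; apply: integrable_within; have cu := continuous_within_primitive _ _ _ T0 ug.
by apply/subspace_continuousP => x xI; apply: cvgM; move/subspace_continuousP : cu; exact.
Qed.

Lemma integration_by_parts_continuous T u g h dh : 0 < T -> continuous g ->
  is_primitive T u g -> (forall x, is_derive x (1 : R) h (dh x)) -> continuous dh ->
  \int[mu]_(x in `[0, T]) (u x * dh x) =
  u T * h T - u 0 * h 0 - \int[mu]_(x in `[0, T]) (g x * h x).
Proof.
move=> T0 cg ug dhE cdh; have [gi uE] := ug.
have ch := is_derive_continuous _ _ dhE.
have uw := continuous_within_primitive _ _ _ (ltW T0) ug.
have [_ u0 uT] := (continuous_within_itvP u T0).1 uw.
have du : {in `]0, T[, forall x, derivable u x 1 /\ u^`()%classic x = g x}.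
  move=> x /[dup] xT; rewrite in_itv/= => /andP[x0 xT'].
  have [] := @continuous_FTC1_closed _ g 0 x T xT' gi x0 (cg x).
  set F := (fun x => _) => dF F'.
  (* [uE] is known on [0, T] only, so differentiability is transferred from F to u by agreement near
     the interior point x. *)
  have nE : \forall y \near x, u y = u 0 + F y.
    near=> y; apply: uE; suff : y \in `]0, T[ by rewrite in_itv/= => /andP[/ltW-> /ltW->].
    by near: y; exact: near_in_itvoo.
  have dx : is_derive x (1 : R) F (g x) by apply: DeriveDef => //; rewrite -derive1E.
  have dx' : is_derive x (1 : R) u (0 + g x).
    apply: near_eq_is_derive (is_deriveD (is_derive_cst (u 0) x (1 : R)) dx).
    by near do apply/esym.
  by rewrite derive1E (@derive_val _ _ _ _ _ _ _ dx') add0r.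
apply: Rintegration_by_parts => //.
- exact: continuous_subspaceT.
- by split => // x /du[].
- by move=> x /du[].
- exact: continuous_subspaceT.
- split; first by move=> x _; apply: (@ex_derive _ _ _ _ _ _ _ (dhE x)).
  + exact/cvg_at_right_filter/ch.
  + exact/cvg_at_left_filter/ch.
- by move=> x _; rewrite derive1E; apply: (@derive_val _ _ _ _ _ _ _ (dhE x)).
Unshelve. all: by end_near. Qed.
Lemma approx_continuous_L1 T g (e : R) : 0 < e -> mu.-integrable `[0, T] (EFin \o g) ->
  exists2 p : R -> R, continuous p & \int[mu]_(x in `[0, T]) `|g x - p x| <= e.
Proof.
move=> e0 gi.
have [||p [cp _ /fine_cvgP[_ ]]] := approximation_continuous_integrable _ _ gi => //.
  exact: compact_finite_measure (@segment_compact _ 0 T).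
move=> /cvgrPdist_le /(_ _ e0)[N _ /(_ N (leqnn N))]/= pN.
exists (p N) => //; apply: le_trans pN; rewrite sub0r normrN.
exact: ler_norm.
Qed.

Lemma is_primitive_shift T (c : R) g : mu.-integrable `[0, T] (EFin \o g) ->
  is_primitive T (fun x => c + \int[mu]_(t in `[0, x]) g t) g.
Proof. by move=> gi; split => // x _; rewrite set_itv1 Rintegral_set1 addr0. Qed.

Lemma integrable_itvW g T x : x <= T -> mu.-integrable `[0, T] (EFin \o g) ->
  mu.-integrable `[0, x] (EFin \o g).
Proof. by move=> xT; apply: integrableS => //; exact: subset_itvl. Qed.

Lemma normr_integrable f a b : mu.-integrable `[a, b] (EFin \o f) ->
  mu.-integrable `[a, b] (EFin \o (fun x => `|f x|)).
Proof. by move=> fi; exact: (integrable_norm fi). Qed.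

Lemma le_normr_RintegralM f h T (M : R) : mu.-integrable `[0, T] (EFin \o f) ->
  mu.-integrable `[0, T] (EFin \o (fun x => f x * h x)) ->
  (forall x, 0 <= x <= T -> `|h x| <= M) ->
  `|\int[mu]_(x in `[0, T]) (f x * h x)| <= M * \int[mu]_(x in `[0, T]) `|f x|.
Proof.
move=> fi fhi hM; apply: (le_trans (le_normr_Rintegral _ fhi)) => //.
rewrite -RintegralZl//; last exact: normr_integrable.
apply: le_Rintegral => //; first exact: normr_integrable.
  by apply: integrableZ_EFin; exact: normr_integrable.
by move=> x /=; rewrite in_itv/= => /hM ?; rewrite normrM mulrC ler_wpM2r.
Qed.

Lemma le_Rintegral_normr_itv f T x : 0 <= x <= T -> mu.-integrable `[0, T] (EFin \o f) ->
  \int[mu]_(t in `[0, x]) `|f t| <= \int[mu]_(t in `[0, T]) `|f t|.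
Proof.
move=> /andP[x0 xT] fi; have fi' := normr_integrable _ _ _ fi.
rewrite -subr_ge0 Rintegral_itvB ?bnd_simp//.
exact: Rintegral_ge0.
Qed.

Lemma continuous_bounded_segment h T : continuous h ->
  exists M, forall x, 0 <= x <= T -> `|h x| <= M.
Proof.
move=> ch; have [M [_ Mh]] := compact_bounded (continuous_compact
  (@continuous_subspaceT _ _ `[0, T] _ ch) (@segment_compact _ 0 T)).
exists (M + 1) => x xT; apply: Mh; first by rewrite ltrDl.
by exists x => //=; rewrite in_itv.
Qed.

(* Only g is rough: approximate it in L1 by continuous functions. *)
Lemma integration_by_parts_primitive T u g h dh : 0 < T ->
  is_primitive T u g -> (forall x, is_derive x (1 : R) h (dh x)) -> continuous dh ->
  \int[mu]_(x in `[0, T]) (u x * dh x) =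
  u T * h T - u 0 * h 0 - \int[mu]_(x in `[0, T]) (g x * h x).
Proof.
move=> T0 ug dhE cdh; have ch := is_derive_continuous _ _ dhE.
have [gi uE] := ug; have T0' := ltW T0.
have [M hM] := continuous_bounded_segment _ T ch.
set K := \int[mu]_(x in `[0, T]) `|dh x|.
have K0 : 0 <= K by exact: Rintegral_ge0.
have hT : `|h T| <= M by apply: hM; rewrite T0' lexx.
have M0 : 0 <= M by exact: le_trans hT.
have dhi := continuous_segment_integrable _ 0 T cdh.
(* The three errors below are d * K, d * M and M * d; the extra 1 keeps the divisor positive. *)
have KM : 0 < K + 2 * M + 1 by rewrite ltr_wpDl// addr_ge0// mulr_ge0.
apply/eqP; rewrite -subr_eq0 -normr_le0; apply/ler_addgt0Pr => e e0; rewrite add0r.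
have [p cp gp] := approx_continuous_L1 _ _ _ (divr_gt0 e0 KM) gi.
set d := e / _ in gp.
have p_i := continuous_segment_integrable _ 0 T cp.
(* The primitive of the approximation p starts from the same value as u: the boundary terms at 0
   then cancel, and u - v is bounded by the L1 error everywhere. *)
pose v x := u 0 + \int[mu]_(t in `[0, x]) p t.
have vp : is_primitive T v p by exact: is_primitive_shift.
have v0 : v 0 = u 0 by rewrite /v set_itv1 Rintegral_set1 addr0.
have gpi := integrableB_EFin _ _ _ _ gi p_i.
have uv x : 0 <= x <= T -> `|u x - v x| <= d.
  move=> /[dup] x0T /andP[x0 xT]; rewrite uE// /v opprD addrACA subrr add0r.
  rewrite -RintegralB//; [|exact: integrable_itvW gi|exact: integrable_itvW p_i].
  apply: (le_trans (le_normr_Rintegral _ _)) => //; first exact: integrable_itvW gpi.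
  exact/(le_trans _ gp)/le_Rintegral_normr_itv.
have ui := integrable_primitive_mul _ _ _ _ T0' ug cdh.
have vi := integrable_primitive_mul _ _ _ _ T0' vp cdh.
have ghi := integrableM_continuous _ _ _ _ gi ch.
have phi := integrableM_continuous _ _ _ _ p_i ch.
have E1 : \int[mu]_(x in `[0, T]) (dh x * (u x - v x)) =
    \int[mu]_(x in `[0, T]) (u x * dh x) - \int[mu]_(x in `[0, T]) (v x * dh x).
  by rewrite -RintegralB//; apply: eq_Rintegral => x _; ring.
have E2 : \int[mu]_(x in `[0, T]) ((g x - p x) * h x) =
    \int[mu]_(x in `[0, T]) (g x * h x) - \int[mu]_(x in `[0, T]) (p x * h x).
  by rewrite -RintegralB//; apply: eq_Rintegral => x _; ring.
have := integration_by_parts_continuous _ _ _ _ _ T0 cp vp dhE cdh.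
rewrite v0 => E3.
have B1 : `|\int[mu]_(x in `[0, T]) (dh x * (u x - v x))| <= d * K.
  apply: le_normr_RintegralM => //.
  have -> : (fun x => dh x * (u x - v x)) = fun x => u x * dh x - v x * dh x.
    by apply/funext => x; ring.
  exact: integrableB_EFin.
have B2 : `|\int[mu]_(x in `[0, T]) ((g x - p x) * h x)| <= M * d.
  apply: le_trans (ler_wpM2l M0 gp); apply: le_normr_RintegralM => //.
  exact: integrableM_continuous.
have B3 : `|(u T - v T) * h T| <= d * M.
  by rewrite normrM ler_pM// uv// T0' lexx.
have -> : \int[mu]_(x in `[0, T]) (u x * dh x) -
    (u T * h T - u 0 * h 0 - \int[mu]_(x in `[0, T]) (g x * h x)) =
  \int[mu]_(x in `[0, T]) (dh x * (u x - v x)) - (u T - v T) * h T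
  + \int[mu]_(x in `[0, T]) ((g x - p x) * h x).
  rewrite E1 E2; rewrite E3; ring.
apply: (le_trans (ler_normD _ _)); apply: (le_trans (lerD (ler_normB _ _) B2)).
apply: (le_trans (lerD (lerD B1 B3) (lexx _))).
have -> : e = d * (K + 2 * M + 1) by rewrite /d divfK// lt0r_neq0.
have : 0 <= d by rewrite divr_ge0// ltW.
nra.
Qed.

End AbsolutelyContinuous.

(** * Rate of convergence of the Fourier series *)

Section CauchySchwarz.
Context {R : realType}.
Local Notation mu := (@lebesgue_measure R).

(** Shared by the integral and the weighted finite-sum Cauchy-Schwarz inequalities. The sign of A is
    deduced from the hypothesis, hence the cases A < 0 and A = 0. *)
Lemma discriminant_le (A P H : R) :
  (forall c, 0 <= c ^+ 2 * A - 2 * c * P + H) -> P ^+ 2 <= A * H.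
Proof.
move=> h; have H0 : 0 <= H by have := h 0; rewrite expr0n/=; lra.
have A0 : 0 <= A.
  rewrite leNgt; apply/negP => A0.
  have [c c1 cA] : exists2 c : R, 1 <= c & H + 2 * `|P| * c < - A * c ^+ 2.
    have nA : 0 < - A by lra.
    (* With t = (H + 2 |P|) / (-A) and c = 1 + t >= 1, one has -A c^2 = -A c + (H + 2 |P|) c, which
       exceeds H + 2 |P| c. *)
    exists (1 + (H + 2 * `|P|) / - A); first by rewrite lerDl divr_ge0 ?addr_ge0// ltW.
    have : (- A) * ((H + 2 * `|P|) / - A) = H + 2 * `|P| by field; lra.
    have : 0 <= (H + 2 * `|P|) / - A by rewrite divr_ge0 ?addr_ge0// ltW.
    move: ((H + 2 * `|P|) / - A) (normr_ge0 P) => c c0; move: `|P| => p p0 e.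
    nra.
  have := h (- c); have := ler_norm P; have := ler_norm (- P); rewrite normrN.
  move: `|P| cA => p; nra.
have [A00|A1] := eqVneq A 0.
  suff -> : P = 0 by rewrite expr0n/= mulr_ge0.
  (* For A = 0 and P nonzero, the hypothesis at c = (H + 1) / (2 P) would read 0 <= -1. *)
  apply/eqP; case: (ltgtP P 0) => // P0.
  - by have := h ((H + 1) / (2 * P)); rewrite A00 mulr0 (_ : 2 * _ * P = H + 1); [lra|field; lra].
  - by have := h ((H + 1) / (2 * P)); rewrite A00 mulr0 (_ : 2 * _ * P = H + 1); [lra|field; lra].
have Ap : 0 < A by rewrite lt0r A1.
have := h (P / A); rewrite (_ : _ - _ + _ = H - P ^+ 2 / A); last by field.
by rewrite subr_ge0 ler_pdivrMr// mulrC.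
Qed.

Lemma Rintegral_CauchySchwarz (f h : R -> R) a b :
  mu.-integrable `[a, b] (EFin \o (fun x => f x ^+ 2)) ->
  mu.-integrable `[a, b] (EFin \o (fun x => h x ^+ 2)) ->
  mu.-integrable `[a, b] (EFin \o (fun x => f x * h x)) ->
  (\int[mu]_(x in `[a, b]) (f x * h x)) ^+ 2 <=
  (\int[mu]_(x in `[a, b]) (f x ^+ 2)) * \int[mu]_(x in `[a, b]) (h x ^+ 2).
Proof.
move=> f2 h2 fh; apply: discriminant_le => c.
have := integrableZ_EFin _ _ _ (c ^+ 2) f2; have := integrableZ_EFin _ _ _ (2 * c) fh.
move=> i1 i2; rewrite -!RintegralZl// -RintegralB// -RintegralD//; last exact: integrableB_EFin.
apply: Rintegral_ge0 => x _.
by rewrite (_ : _ + _ = (c * f x - h x) ^+ 2) ?sqr_ge0//; ring.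
Qed.

Lemma sum_CauchySchwarz n (a w : nat -> R) : (forall k, 0 < w k) ->
  (\sum_(k < n) a k) ^+ 2 <=
  (\sum_(k < n) w k * a k ^+ 2) * \sum_(k < n) (w k)^-1.
Proof.
move=> w0; apply: discriminant_le => c.
rewrite !big_distrr -sumrB -big_split/=; apply: sumr_ge0 => k _.
have wk := lt0r_neq0 (w0 k).
rewrite (_ : _ + _ = (c * w k * a k - 1) ^+ 2 / w k); last by field.
by rewrite divr_ge0 ?sqr_ge0// ltW.
Qed.

End CauchySchwarz.

(** * The sawtooth kernel and its Fourier coefficients *)

Section Sawtooth.
Context {R : realType}.
Local Notation mu := (@lebesgue_measure R).
Local Notation I := (`[0%R, 2 * pi]%classic : set R).
Implicit Types (f : R -> R) (x : R).

(* A primitive u of g with mean 0 and period 2 pi satisfies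
   2 pi u(x) = int g (sawtooth x). *)
Definition sawtooth x (t : R) : R := t - x - pi + 2 * pi * \1_(`[0, x]) t.

Lemma integrable_indic f x : mu.-integrable I (EFin \o f) ->
  mu.-integrable I (EFin \o (fun t => f t * \1_(`[0, x]) t)).
Proof.
move=> fi; apply: (integrableMl _ fi) => //.
exists 1; split; rewrite ?num_real// => M M1 t _ /=.
by rewrite indicE; case: (_ \in _); rewrite ?normr1 ?normr0 ltW// (lt_trans _ M1).
Qed.

Lemma Rintegral_indic_mul f x : 0 <= x <= 2 * pi ->
  \int[mu]_(t in I) (f t * \1_(`[0, x]) t) = \int[mu]_(t in `[0, x]) f t.
Proof.
move=> /andP[x0 xp].
have -> : `[0, x]%classic = I `&` `[0, x]%classic :> set R.
  by apply/esym/setIidPr; exact: subset_itvl.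
rewrite Rintegral_mkcondr; apply: eq_Rintegral => t _.
rewrite patchE indicE setIidr; last exact: subset_itvl.
by case: (t \in _); rewrite ?mulr1 ?mulr0.
Qed.

Lemma integrable_mul_sawtooth f x : 0 <= x <= 2 * pi -> mu.-integrable I (EFin \o f) ->
  mu.-integrable I (EFin \o (fun t => f t * sawtooth x t)).
Proof.
move=> xI fi.
have -> : (fun t => f t * sawtooth x t) =
    (fun t => f t * (t - x - pi) + 2 * pi * (f t * \1_(`[0, x]) t)).
  by apply/funext => t; rewrite /sawtooth; ring.
apply: integrableD_EFin.
  apply: integrableM_continuous => // t.
  by apply: cvgB; [apply: cvgB; [exact: cvg_id|exact: cvg_cst]|exact: cvg_cst].
by apply: integrableZ_EFin; exact: integrable_indic.
Qed.

Lemma Rintegral_mul_sawtooth f x : 0 <= x <= 2 * pi -> mu.-integrable I (EFin \o f) ->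
  \int[mu]_(t in I) (f t * sawtooth x t) =
  \int[mu]_(t in I) (f t * t) - (x + pi) * \int[mu]_(t in I) f t
  + 2 * pi * \int[mu]_(t in `[0, x]) f t.
Proof.
move=> xI fi.
have i1 : mu.-integrable I (EFin \o (fun t => f t * t)).
  by apply: integrableM_continuous => // t; exact: cvg_id.
have i2 := integrable_indic _ x fi.
rewrite -(Rintegral_indic_mul _ _ xI) -!RintegralZl// -RintegralB//; last exact: integrableZ_EFin.
rewrite -RintegralD//; last 2 first.
- by apply: integrableB_EFin => //; exact: integrableZ_EFin.
- exact: integrableZ_EFin.
by apply: eq_Rintegral => t _; rewrite /sawtooth; ring.
Qed.

End Sawtooth.

Section SawtoothCoefficients.
Context {R : realType}.
Local Notation mu := (@lebesgue_measure R).
Local Notation I := (`[0%R, 2 * pi]%classic : set R).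
Implicit Types (f : R -> R) (x : R).

Lemma integrable_sawtooth x : 0 <= x <= 2 * pi ->
  mu.-integrable I (EFin \o sawtooth x).
Proof.
move=> xI; have c1 : continuous (fun _ : R => 1 : R) by exact: cst_continuous.
have := integrable_mul_sawtooth _ _ xI (continuous_segment_integrable _ 0 (2 * pi) c1).
by under [X in _.-integrable _ (_ \o X)]eq_fun do rewrite mul1r.
Qed.

Lemma Rintegral_id a : 0 <= a -> \int[mu]_(t in `[0, a]) t = a ^+ 2 / 2.
Proof.
move=> a0.
have d (x : R) : is_derive x (1 : R) (fun t => 2^-1 * t ^+ 2) x.
  have -> : (fun t : R => 2^-1 * t ^+ 2) = 2^-1 *: (id ^+ 2) by rewrite exprfctE.
  apply: (is_derive_eq (@is_deriveZ _ _ _ _ 2^-1 _ _ _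
    (@is_deriveX _ _ _ 2 _ _ _ (is_derive_id x (1 : R))))).
  by rewrite /GRing.scale/=; field.
rewrite (Rintegral_FTC (fun t => 2^-1 * t ^+ 2))//; last by move=> x; exact: cvg_id.
by field.
Qed.

Lemma Rintegral_sqr a : 0 <= a -> \int[mu]_(t in `[0, a]) (t ^+ 2) = a ^+ 3 / 3.
Proof.
move=> a0.
have d (x : R) : is_derive x (1 : R) (fun t => 3^-1 * t ^+ 3) (x ^+ 2).
  have -> : (fun t : R => 3^-1 * t ^+ 3) = 3^-1 *: (id ^+ 3) by rewrite exprfctE.
  apply: (is_derive_eq (@is_deriveZ _ _ _ _ 3^-1 _ _ _
    (@is_deriveX _ _ _ 3 _ _ _ (is_derive_id x (1 : R))))).
  by rewrite /GRing.scale/=; field.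
rewrite (Rintegral_FTC (fun t => 3^-1 * t ^+ 3))//; last exact: exprn_continuous.
by field.
Qed.

Lemma Rintegral_cosM_id k :
  \int[mu]_(t in I) (cos (k.+1%:R * t) * t) = 0 :> R.
Proof.
set c : R := k.+1%:R; have c0 : c != 0 by rewrite pnatr_eq0.
have d (x : R) : is_derive x (1 : R)
    (fun t => c^-1 * (t * sin (c * t)) + c ^- 2 * cos (c * t)) (cos (c * x) * x).
  have d1 : is_derive x (1 : R) (fun t => t * sin (c * t)) _ :=
    is_deriveM (is_derive_id x (1 : R)) (is_derive_sinM c x).
  apply: (is_derive_eq (is_deriveD (@is_deriveZ _ _ _ _ c^-1 _ _ _ d1)
    (@is_deriveZ _ _ _ _ (c ^- 2) _ _ _ (is_derive_cosM c x)))).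
  by rewrite /GRing.scale/=; field.
rewrite (Rintegral_FTC (fun t => c^-1 * (t * sin (c * t)) + c ^- 2 * cos (c * t))).
- by rewrite sin_nat_period cos_nat_period !mulr0 cos0 sin0; ring.
- exact: period_ge0.
- by move=> x; apply: cvgM; [exact: continuous_cosM|exact: cvg_id].
Qed.

Lemma Rintegral_sinM_id k :
  \int[mu]_(t in I) (sin (k.+1%:R * t) * t) = - (2 * pi) / k.+1%:R :> R.
Proof.
set c : R := k.+1%:R; have c0 : c != 0 by rewrite pnatr_eq0.
have d (x : R) : is_derive x (1 : R)
    (fun t => - c^-1 * (t * cos (c * t)) + c ^- 2 * sin (c * t)) (sin (c * x) * x).
  have d1 : is_derive x (1 : R) (fun t => t * cos (c * t)) _ :=
    is_deriveM (is_derive_id x (1 : R)) (is_derive_cosM c x).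
  apply: (is_derive_eq (is_deriveD (@is_deriveZ _ _ _ _ (- c^-1) _ _ _ d1)
    (@is_deriveZ _ _ _ _ (c ^- 2) _ _ _ (is_derive_sinM c x)))).
  by rewrite /GRing.scale/=; field.
rewrite (Rintegral_FTC (fun t => - c^-1 * (t * cos (c * t)) + c ^- 2 * sin (c * t))).
- by rewrite sin_nat_period cos_nat_period !mulr0 cos0 sin0; ring.
- exact: period_ge0.
- by move=> x; apply: cvgM; [exact: continuous_sinM|exact: cvg_id].
Qed.

Lemma Rintegral_cosM_itv k x : 0 <= x ->
  \int[mu]_(t in `[0, x]) cos (k.+1%:R * t) = sin (k.+1%:R * x) / k.+1%:R.
Proof.
move=> x0; set c : R := k.+1%:R; have c0 : c != 0 by rewrite pnatr_eq0.
have d (y : R) : is_derive y (1 : R) (fun t => c^-1 * sin (c * t)) (cos (c * y)).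
  apply: (is_derive_eq (@is_deriveZ _ _ _ _ c^-1 _ _ _ (is_derive_sinM c y))).
  by rewrite /GRing.scale/= mulKf.
rewrite (Rintegral_FTC (fun t => c^-1 * sin (c * t)))//; last exact: continuous_cosM.
by rewrite mulr0 sin0 mulr0 subr0 mulrC.
Qed.

Lemma Rintegral_sinM_itv k x : 0 <= x ->
  \int[mu]_(t in `[0, x]) sin (k.+1%:R * t) = (1 - cos (k.+1%:R * x)) / k.+1%:R.
Proof.
move=> x0; set c : R := k.+1%:R; have c0 : c != 0 by rewrite pnatr_eq0.
have d (y : R) : is_derive y (1 : R) (fun t => - c^-1 * cos (c * t)) (sin (c * y)).
  apply: (is_derive_eq (@is_deriveZ _ _ _ _ (- c^-1) _ _ _ (is_derive_cosM c y))).
  by rewrite /GRing.scale/= mulrNN mulKf.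
rewrite (Rintegral_FTC (fun t => - c^-1 * cos (c * t)))//; last exact: continuous_sinM.
by rewrite mulr0 cos0; ring.
Qed.

Lemma fcos_sawtooth k x : 0 <= x <= 2 * pi ->
  fcos (sawtooth x) k = 2 * pi * (sin (k.+1%:R * x) / k.+1%:R).
Proof.
move=> xI; have x0 : 0 <= x by case/andP: xI.
rewrite /fcos; under eq_Rintegral do rewrite mulrC.
have ci := continuous_segment_integrable _ 0 (2 * pi) (continuous_cosM (k.+1%:R : R)).
rewrite Rintegral_mul_sawtooth// Rintegral_cosM_id Rintegral_cosM_itv//.
by rewrite Rintegral_cosM ?sin_nat_period ?pnatr_eq0// mulr0 subrr add0r.
Qed.

Lemma fsin_sawtooth k x : 0 <= x <= 2 * pi ->
  fsin (sawtooth x) k = - (2 * pi * (cos (k.+1%:R * x) / k.+1%:R)).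
Proof.
move=> xI; have x0 : 0 <= x by case/andP: xI.
rewrite /fsin; under eq_Rintegral do rewrite mulrC.
have ci := continuous_segment_integrable _ 0 (2 * pi) (continuous_sinM (k.+1%:R : R)).
rewrite Rintegral_mul_sawtooth// Rintegral_sinM_id Rintegral_sinM_itv//.
by rewrite Rintegral_sinM ?cos_nat_period// mulr0 subr0; ring.
Qed.

(** On the period [sawtooth x] is a cyclic translate of t - pi, so the value is independent of x.
    The computation takes the sawtooth itself as f in [Rintegral_mul_sawtooth], which leaves the
    three elementary integrals [Ss], [St] and [Sx]. *)
Lemma Rintegral_sawtooth_sq x : 0 <= x <= 2 * pi ->
  \int[mu]_(t in I) (sawtooth x t ^+ 2) = 2 / 3 * pi ^+ 3.
Proof.
move=> xI; have x0 : 0 <= x by case/andP: xI.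
have p0 := @period_ge0 R.
have c1 : continuous (fun _ : R => 1 : R) by exact: cst_continuous.
have cid : continuous (id : R -> R) by move=> y; exact: cvg_id.
have Ss : \int[mu]_(t in I) sawtooth x t = 0.
  under eq_Rintegral do rewrite -[sawtooth _ _]mul1r.
  rewrite (Rintegral_mul_sawtooth (fun=> 1))//; last exact: continuous_segment_integrable.
  under eq_Rintegral do rewrite mul1r.
  rewrite Rintegral_id// Rintegral_const.
  rewrite (Rintegral_FTC id)//; by field.
have St : \int[mu]_(t in I) (sawtooth x t * t) = 2 / 3 * pi ^+ 3 - 2 * pi ^+ 2 * x + pi * x ^+ 2.
  under eq_Rintegral do rewrite mulrC.
  rewrite (Rintegral_mul_sawtooth id)//; last exact: continuous_segment_integrable.
  under eq_Rintegral do rewrite -expr2.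
  by rewrite Rintegral_sqr// !Rintegral_id//; field.
have Sx : \int[mu]_(t in `[0, x]) sawtooth x t = x ^+ 2 / 2 - x ^+ 2 + pi * x.
  have -> : \int[mu]_(t in `[0, x]) sawtooth x t = \int[mu]_(t in `[0, x]) (t + (pi - x)).
    by apply: eq_Rintegral => t tx; rewrite /sawtooth indicE tx mulr1; ring.
  rewrite RintegralD//; last 2 first.
  - exact: continuous_segment_integrable.
  - exact/continuous_segment_integrable/cst_continuous.
  have d (y : R) := is_derive_mull (pi - x) y.
  rewrite Rintegral_id// (Rintegral_FTC ( *%R (pi - x)))//; last exact: cst_continuous.
  by ring.
under eq_Rintegral do rewrite expr2.
rewrite Rintegral_mul_sawtooth//; last exact: integrable_sawtooth.
rewrite Ss St Sx; by field.
Qed.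

(** Here the factor [pi^-1] of the Fourier coefficient is already included. *)
Definition sawtooth_coef_cos x k : R := 2 * (sin (k.+1%:R * x) / k.+1%:R).
Definition sawtooth_coef_sin x k : R := - (2 * (cos (k.+1%:R * x) / k.+1%:R)).

Definition sawtooth_rem x n t : R :=
  sawtooth x t - trigpoly (sawtooth_coef_cos x) (sawtooth_coef_sin x) n t.

Lemma integrable_sawtooth_sq x : 0 <= x <= 2 * pi ->
  mu.-integrable I (EFin \o (fun t => sawtooth x t ^+ 2)).
Proof. by move=> xI; apply: integrable_mul_sawtooth => //; exact: integrable_sawtooth. Qed.

(** The squares of the two coefficients of frequency k + 1 add up to 4 / (k + 1)^2 by cos^2 + sin^2
    = 1, and the total 2 pi^3 / 3 is 4 pi times pi^2 / 6. So the error is a Basel tail, the same for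
    every x. *)
Lemma Rintegral_sawtooth_rem_sq x n : 0 <= x <= 2 * pi ->
  \int[mu]_(t in I) (sawtooth_rem x n t ^+ 2) = 4 * pi * basel_tail n.
Proof.
move=> xI; rewrite Rintegral_sqB_trigpoly; last 2 first.
- exact: integrable_sawtooth.
- exact: integrable_sawtooth_sq.
rewrite Rintegral_sawtooth_sq// /basel_tail mulrBr.
have -> : 4 * pi * (pi ^+ 2 / 6) = 2 / 3 * pi ^+ 3 :> R by field.
rewrite -addrA; congr (_ + _); rewrite !mulr_sumr -!sumrN -big_split/=.
apply: eq_bigr => k _; rewrite fcos_sawtooth// fsin_sawtooth//.
rewrite /sawtooth_coef_cos /sawtooth_coef_sin.
have k0 : k.+1%:R != 0 :> R by rewrite pnatr_eq0.
have := cos2Dsin2 (k.+1%:R * x).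
move: k.+1%:R k0 (cos _) (sin _) (pi) => c c0 C S p e.
have -> : - (4 * p * c ^- 2) = - (4 * p * c ^- 2) * (C ^+ 2 + S ^+ 2) by rewrite e mulr1.
by field.
Qed.

End SawtoothCoefficients.

(** * Fourier sums of a periodic mean-zero primitive *)

Section FourierPrimitive.
Context {R : realType}.
Local Notation mu := (@lebesgue_measure R).
Local Notation I := (`[0%R, 2 * pi]%classic : set R).
Variables (u g : R -> R).
Hypothesis ug : is_primitive (2 * pi) u g.
Hypothesis u_per : u (2 * pi) = u 0.
Hypothesis u_mean : \int[mu]_(x in I) u x = 0.
Hypothesis g2i : mu.-integrable I (EFin \o (fun x => g x ^+ 2)).

Let gi : mu.-integrable I (EFin \o g) := ug.1.
Let pi0 : 0 <= 2 * pi :> R := period_ge0.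
Let twopi_gt0 : 0 < 2 * pi :> R. Proof. by rewrite mulr_gt0 ?pi_gt0. Qed.
Let A := \int[mu]_(x in I) (u x ^+ 2).
Let B := \int[mu]_(x in I) (g x ^+ 2).

Let ui : mu.-integrable I (EFin \o u).
Proof. exact/integrable_within/(continuous_within_primitive _ _ _ pi0 ug). Qed.

Let u2i : mu.-integrable I (EFin \o (fun x => u x ^+ 2)).
Proof. exact: integrable_primitive_sq pi0 ug. Qed.

Lemma fcos_derivative k : fcos g k = k.+1%:R * fsin u k.
Proof.
have dc (x : R) := is_derive_cosM k.+1%:R x.
have cdh : continuous (fun x : R => - (k.+1%:R * sin (k.+1%:R * x))).
  by move=> x; apply: cvgN; apply: cvgZr; exact: continuous_sinM.
have := integration_by_parts_primitive _ _ _ _ _ twopi_gt0 ug dc cdh.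
rewrite cos_nat_period mulr0 cos0 u_per subrr sub0r -/(fcos g k) => e.
apply: oppr_inj; rewrite -e -mulNr -RintegralZl//.
  by apply: eq_Rintegral => x _; ring.
by apply: (integrable_primitive_mul _ _ _ _ pi0 ug); exact: continuous_sinM.
Qed.

Lemma fsin_derivative k : fsin g k = - (k.+1%:R * fcos u k).
Proof.
have ds (x : R) := is_derive_sinM k.+1%:R x.
have cdh : continuous (fun x : R => k.+1%:R * cos (k.+1%:R * x)).
  by move=> x; apply: cvgZr; exact: continuous_cosM.
have := integration_by_parts_primitive _ _ _ _ _ twopi_gt0 ug ds cdh.
rewrite sin_nat_period !mulr0 sin0 mulr0 subrr sub0r -/(fsin g k) => e.
apply: oppr_inj; rewrite -e opprK -RintegralZl//.
  by apply: eq_Rintegral => x _; ring.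
by apply: (integrable_primitive_mul _ _ _ _ pi0 ug); exact: continuous_cosM.
Qed.

Lemma Rintegral_derivative x : 0 <= x <= 2 * pi -> \int[mu]_(t in `[0, x]) g t = u x - u 0.
Proof. by move=> xI; rewrite (ug.2 _ xI) addrC addKr. Qed.

(** Since u has mean 0, integrating g against t by parts gives 2 pi u(0); the jump of the sawtooth
    contributes 2 pi (u(x) - u(0)), and g itself has integral 0 by periodicity. *)
Lemma Rintegral_derivative_sawtooth x : 0 <= x <= 2 * pi ->
  \int[mu]_(t in I) (g t * sawtooth x t) = 2 * pi * u x.
Proof.
move=> xI; rewrite Rintegral_mul_sawtooth// !Rintegral_derivative//; last by rewrite pi0 lexx.
have c1 : continuous (fun _ : R => 1 : R) by exact: cst_continuous.
have := integration_by_parts_primitive _ _ _ _ _ twopi_gt0 ug (fun x => is_derive_id x (1 : R)) c1.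
under eq_Rintegral do rewrite mulr1.
by rewrite u_mean u_per => e; have -> : \int[mu]_(t in I) (g t * t) = 2 * pi * u 0; [lra|ring].
Qed.

Definition Fourier_sum n := trigpoly (fun k => pi^-1 * fcos u k) (fun k => pi^-1 * fsin u k) n.

(** The factor k + 1 gained by differentiating u cancels the 1 / (k + 1) of the sawtooth
    coefficients, so pairing g with the n-th partial sum of the sawtooth gives 2 pi times the n-th
    partial sum of u. *)
Lemma Fourier_sum_rem x n : 0 <= x <= 2 * pi ->
  \int[mu]_(t in I) (g t * sawtooth_rem x n t) = 2 * pi * (u x - Fourier_sum n x).
Proof.
move=> xI; rewrite mulrBr -Rintegral_derivative_sawtooth//.
have E t : g t * sawtooth_rem x n t = g t * sawtooth x t
    - g t * trigpoly (sawtooth_coef_cos x) (sawtooth_coef_sin x) n t.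
  by rewrite mulrBr.
under eq_Rintegral do rewrite E.
rewrite RintegralB//; last 2 first.
- exact: integrable_mul_sawtooth.
- by apply: integrableM_continuous => //; exact: continuous_trigpoly.
congr (_ - _); rewrite Rintegral_mul_trigpoly// mulr_sumr; apply: eq_bigr => k _.
rewrite fcos_derivative fsin_derivative /sawtooth_coef_cos /sawtooth_coef_sin.
have k0 : k.+1%:R != 0 :> R by rewrite pnatr_eq0.
have := lt0r_neq0 (pi_gt0 R).
move: k.+1%:R k0 (cos _) (sin _) (fcos _ _) (fsin _ _) (pi) => c c0 C S a b p p0.
by field; rewrite p0 c0.
Qed.

(** Cauchy-Schwarz in [Fourier_sum_rem]. Being uniform in x, the bound serves both for convergence
    at 0 and, once integrated, for [Parseval_le]. *)
Lemma Fourier_sum_dist x n : 0 <= x <= 2 * pi ->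
  (u x - Fourier_sum n x) ^+ 2 <= B * basel_tail n / pi.
Proof.
move=> xI.
have ct := continuous_trigpoly (sawtooth_coef_cos x) (sawtooth_coef_sin x) n.
have ri f : mu.-integrable I (EFin \o f) ->
    mu.-integrable I (EFin \o (fun t => f t * sawtooth_rem x n t)).
  move=> fi; rewrite /sawtooth_rem; under [X in _ \o X]eq_fun do rewrite mulrBr.
  apply: integrableB_EFin; first exact: integrable_mul_sawtooth.
  exact: integrableM_continuous.
have ri1 : mu.-integrable I (EFin \o sawtooth_rem x n).
  apply: integrableB_EFin; first exact: integrable_sawtooth.
  exact: continuous_segment_integrable.
have := Rintegral_CauchySchwarz _ _ _ _ g2i (ri _ ri1) (ri _ gi).
rewrite Fourier_sum_rem// Rintegral_sawtooth_rem_sq// -/B => cs.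
rewrite ler_pdivlMr ?pi_gt0//.
have p0 := pi_gt0 R; rewrite -(@ler_pM2l _ (4 * pi)) ?mulr_gt0//.
by apply: le_trans (le_trans _ cs) _; rewrite le_eqVlt; apply/orP; left; apply/eqP; ring.
Qed.

Lemma Parseval_le n :
  A <= pi^-1 * (\sum_(k < n) (fcos u k ^+ 2 + fsin u k ^+ 2)) + 2 * B * basel_tail n.
Proof.
rewrite -lerBlDl -Rintegral_sqB_Fourier//.
have c1 (c : R) : continuous (fun _ : R => c : R) by exact: cst_continuous.
rewrite (_ : 2 * B * _ = \int[mu]_(x in I) (B * basel_tail n / pi)); last first.
  have e (p t : R) : p != 0 -> 2 * B * t = B * t / p * (2 * p) by move=> p0; field.
  by rewrite Rintegral_const -e// lt0r_neq0// pi_gt0.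
apply: le_Rintegral => //.
- apply: integrable_within; have cu := continuous_within_primitive _ _ _ pi0 ug.
  have ct : {within I, continuous (Fourier_sum n)}.
    exact/continuous_subspaceT/continuous_trigpoly.
  move: cu ct => /subspace_continuousP cu /subspace_continuousP ct.
  by apply/subspace_continuousP => x xI; apply: cvgM; apply: cvgB;
    [exact: cu|exact: ct|exact: cu|exact: ct].
- exact/continuous_segment_integrable/c1.
- by move=> x /=; rewrite in_itv/= => xI; exact: Fourier_sum_dist.
Qed.

Lemma Bessel n : pi^-1 * (\sum_(k < n) (fcos u k ^+ 2 + fsin u k ^+ 2)) <= A.
Proof.
rewrite -subr_ge0 -Rintegral_sqB_Fourier//.
by apply: Rintegral_ge0 => x _; exact: sqr_ge0.
Qed.

Lemma Bessel_derivative n :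
  pi^-1 * (\sum_(k < n) k.+1%:R ^+ 2 * (fcos u k ^+ 2 + fsin u k ^+ 2)) <= B.
Proof.
rewrite (_ : \sum_(k < n) _ = \sum_(k < n) (fcos g k ^+ 2 + fsin g k ^+ 2)); last first.
  by apply: eq_bigr => k _; rewrite fcos_derivative fsin_derivative; ring.
rewrite -subr_ge0 -Rintegral_sqB_Fourier//.
by apply: Rintegral_ge0 => x _; exact: sqr_ge0.
Qed.

Lemma energy_ge n (l : R) : -1 < l ->
  pi^-1 * \sum_(k < n) (l + k.+1%:R ^+ 2) * fcos u k ^+ 2 <=
  B + l * A + 2 * `|l| * B * basel_tail n.
Proof.
move=> l1; have B0 : 0 <= B by apply: Rintegral_ge0 => x _; exact: sqr_ge0.
have t0 := @basel_tail_ge0 R n.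
set S := \sum_(k < n) (fcos u k ^+ 2 + fsin u k ^+ 2).
have E : pi^-1 * \sum_(k < n) (l + k.+1%:R ^+ 2) * fcos u k ^+ 2 <=
    B + l * (pi^-1 * S).
  apply: le_trans (lerD (Bessel_derivative n) (lexx _)).
  rewrite [l * _]mulrCA -mulrDr ler_wpM2l ?invr_ge0 ?pi_ge0// /S mulr_sumr -big_split/=.
  apply: ler_sum => k _.
  (* The sine coefficients do not contribute to u(0); their weight is positive for l > -1, so they
     can be discarded. *)
  have : 0 <= (l + k.+1%:R ^+ 2) * fsin u k ^+ 2.
    rewrite mulr_ge0 ?sqr_ge0//.
    have : 1 <= k.+1%:R ^+ 2 :> R by rewrite -natrX ler1n expn_gt0.
    by lra.
  by move: (fcos u k) (fsin u k) (k.+1%:R : R) => a b c; lra.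
apply: (le_trans E); rewrite -addrA lerD2l.
have := Bessel n; have := Parseval_le n; rewrite -/S.
have Bt : 0 <= B * basel_tail n by rewrite mulr_ge0.
move: (pi^-1 * S) => s h1 h2.
(* For l >= 0 this is Bessel's inequality. For l < 0 the sign reverses and [Parseval_le] supplies
   the error term. *)
have [l0|l0] := leP 0 l; first by rewrite ger0_norm//; nra.
by rewrite ltr0_norm//; nra.
Qed.

Lemma point_value_le n (l : R) : -1 < l ->
  (pi^-1 * \sum_(k < n) fcos u k) ^+ 2 <=
  (B + l * A + 2 * `|l| * B * basel_tail n) *
  (pi^-1 * \sum_(k < n) (l + k.+1%:R ^+ 2)^-1).
Proof.
move=> l1; have w0 k : 0 < l + k.+1%:R ^+ 2.
  have : 1 <= k.+1%:R ^+ 2 :> R by rewrite -natrX ler1n expn_gt0.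
  by lra.
have p0 : 0 <= pi^-1 :> R by rewrite invr_ge0 pi_ge0.
rewrite exprMn; apply: (le_trans (ler_wpM2l (sqr_ge0 _) (sum_CauchySchwarz _ _ _ w0))).
rewrite expr2 mulrACA ler_wpM2r ?energy_ge//.
by rewrite mulr_ge0//; apply: sumr_ge0 => k _; rewrite invr_ge0 ltW.
Qed.

Lemma cvg_point_value :
  (pi^-1 * \sum_(k < n) fcos u k) @[n --> \oo] --> u 0.
Proof.
have B0 : 0 <= B by apply: Rintegral_ge0 => x _; exact: sqr_ge0.
have E n : Fourier_sum n 0 = pi^-1 * \sum_(k < n) fcos u k.
  rewrite /Fourier_sum /trigpoly mulr_sumr; apply: eq_bigr => k _.
  by rewrite mulr0 cos0 sin0; ring.
under eq_fun do rewrite -E.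
apply/cvgrPdist_le => e e0.
have : (B * basel_tail n / pi) @[n --> \oo] --> 0.
  rewrite -[0](mul0r pi^-1) -(mulr0 B); apply: cvgMl; apply: cvgMr; exact: cvg_basel_tail.
move=> /cvgrPdist_le /(_ _ (exprn_gt0 2 e0)) [N _ hN].
exists N => // n /= /hN; rewrite sub0r normrN => h.
rewrite -ler_sqr ?nnegrE ?(ltW e0)//. rewrite -normrX ger0_norm ?sqr_ge0//.
apply: le_trans (le_trans _ h); last exact: ler_norm.
by apply: Fourier_sum_dist; rewrite lexx pi0.
Qed.

End FourierPrimitive.

(** * The function G *)

Section GreenSum.
Context {R : realType}.
Implicit Types (l m e : R).

(** Positive frequencies only: the two signs of k turn 1 / (2 pi) into 1 / pi, whence the limit
    [pi * G l]. *)
Definition green_sum l n : R := \sum_(k < n) (l + k.+1%:R ^+ 2)^-1.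

Lemma sqr_succ_ge1 k : 1 <= k.+1%:R ^+ 2 :> R.
Proof. by rewrite -natrX ler1n expn_gt0. Qed.

Lemma green_den_gt0 l k : -1 < l -> 0 < l + k.+1%:R ^+ 2.
Proof. by move=> l1; have := sqr_succ_ge1 k; lra. Qed.

(** The margin e keeps l away from the pole -1 and makes the later estimates uniform on [e - 1, oo).
    The inequality holds because 1 - e <= (1 - e) (k + 1)^2. *)
Lemma green_den_ge e l k : e <= 1 -> e - 1 <= l ->
  e * k.+1%:R ^+ 2 <= l + k.+1%:R ^+ 2.
Proof. by move=> e1 el; have := sqr_succ_ge1 k; nra. Qed.

Lemma green_term_le e l k : 0 < e -> e <= 1 -> e - 1 <= l ->
  (l + k.+1%:R ^+ 2)^-1 <= e^-1 * (k.+1%:R ^+ 2)^-1.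
Proof.
move=> e0 e1 el; have k1 := sqr_succ_ge1 k.
rewrite -invfM lef_pV2 ?posrE ?green_den_ge//; last by rewrite mulr_gt0//; lra.
by apply: green_den_gt0; lra.
Qed.

Lemma green_sum_tail e l (m n : nat) : 0 < e -> e <= 1 -> e - 1 <= l ->
  green_sum l (m + n) <= green_sum l m + e^-1 * basel_tail m.
Proof.
move=> e0 e1 el; rewrite /green_sum big_split_ord/= lerD2l.
have : basel_tail m = basel_tail (m + n) + \sum_(i < n) ((m + i).+1%:R ^+ 2)^-1 :> R.
  by rewrite /basel_tail big_split_ord/=; ring.
move=> ->; rewrite mulrDr ler_wpDl ?mulr_ge0 ?basel_tail_ge0 ?invr_ge0 ?(ltW e0)//.
rewrite mulr_sumr; apply: ler_sum => i _; exact: green_term_le.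
Qed.

Lemma green_sum_nondecreasing l : -1 < l -> nondecreasing_seq (green_sum l).
Proof.
move=> l1; apply/nondecreasing_seqP => n.
by rewrite /green_sum big_ord_recr/= lerDl invr_ge0 ltW// green_den_gt0.
Qed.

Lemma pole_margin l : -1 < l -> exists e, [/\ 0 < e, e <= 1 & e - 1 <= l].
Proof.
move=> l1; exists (Num.min 1 (l + 1)); split.
- by rewrite lt_min ltr01/=; lra.
- by rewrite ge_min lexx.
- by rewrite lerBlDr ge_min lexx orbT.
Qed.

Lemma cvg_green_sum l : -1 < l -> green_sum l n @[n --> \oo] --> pi * G l.
Proof.
move=> l1; have [e [e0 e1 el]] := pole_margin _ l1.
have cW : cvgn (green_sum l).
  apply: nondecreasing_is_cvgn; first exact: green_sum_nondecreasing.
  exists (green_sum l 0 + e^-1 * basel_tail 0) => _ [n _ <-].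
  by have := green_sum_tail _ _ 0 n e0 e1 el.
have -> : pi * G l = limn (green_sum l); last exact: cW.
(* The sum in [G] over 1 <= n < N has N - 1 terms, hence the shift by one. *)
have -> : limn (green_sum l) = limn (fun N => \sum_(1 <= n < N) (l + n%:R ^+ 2)^-1).
  apply/esym/cvg_lim => //; rewrite -cvg_shiftS/=.
  by under eq_fun do rewrite big_add1/= big_mkord.
by rewrite /G; have := lt0r_neq0 (pi_gt0 R); move: (pi) => p p0; field.
Qed.

Lemma green_sum_le l n : -1 < l -> green_sum l n <= pi * G l.
Proof.
move=> l1; have cW := cvg_green_sum _ l1.
rewrite -(cvg_lim _ cW)//; apply: nondecreasing_cvgn_le.
  exact: green_sum_nondecreasing.
by apply/cvg_ex; eexists; exact: cW.
Qed.

Lemma G_le_green_sum e l (m : nat) : 0 < e -> e <= 1 -> e - 1 <= l ->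
  pi * G l <= green_sum l m + e^-1 * basel_tail m.
Proof.
move=> e0 e1 el; have l1 : -1 < l by lra.
have cW := cvg_green_sum _ l1.
rewrite -(cvg_lim _ cW)//; apply: limr_le.
  by apply/cvg_ex; eexists; exact: cW.
exists m => // n /= mn; rewrite -(subnKC mn); exact: green_sum_tail.
Qed.

(** The terms of frequency k differ by at most e^-2 k^-4 |l - m|. One factor k^-2 is bounded by 1
    and the other sums to at most pi^2 / 6, so the Lipschitz constant is independent of n and passes
    to [G]. *)
Lemma green_sum_dist e l m (n : nat) : 0 < e -> e <= 1 -> e - 1 <= l -> e - 1 <= m ->
  `|green_sum l n - green_sum m n| <= e ^- 2 * (pi ^+ 2 / 6) * `|l - m|.
Proof.
move=> e0 e1 el em.
have -> : pi ^+ 2 / 6 = basel_tail n + \sum_(k < n) (k.+1%:R ^+ 2)^-1 :> R.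
  by rewrite /basel_tail subrK.
rewrite /green_sum -sumrB; apply: (le_trans (ler_norm_sum _ _ _)).
rewrite mulrDr mulrDl ler_wpDl ?mulr_ge0 ?basel_tail_ge0 ?invr_ge0 ?exprn_ge0 ?(ltW e0)//.
rewrite mulr_sumr mulr_suml; apply: ler_sum => k _.
have l0 : 0 < l + k.+1%:R ^+ 2 by apply: green_den_gt0; lra.
have m0 : 0 < m + k.+1%:R ^+ 2 by apply: green_den_gt0; lra.
have tl := green_term_le _ _ k e0 e1 el; have tm := green_term_le _ _ k e0 e1 em.
have k1 : (k.+1%:R ^+ 2)^-1 <= 1 :> R by rewrite invf_le1 ?sqr_succ_ge1//
  (lt_le_trans _ (sqr_succ_ge1 k)).
have k0 : 0 <= (k.+1%:R ^+ 2)^-1 :> R by rewrite invr_ge0 sqr_ge0.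
have -> : (l + k.+1%:R ^+ 2)^-1 - (m + k.+1%:R ^+ 2)^-1 =
    (l + k.+1%:R ^+ 2)^-1 * (m + k.+1%:R ^+ 2)^-1 * - (l - m).
  have E (x y : R) : 0 < x -> 0 < y -> x^-1 - y^-1 = x^-1 * y^-1 * - (x - y).
    by move=> x0 y0; field; rewrite !lt0r_neq0.
  by rewrite E//; congr (_ * - _); ring.
rewrite normrM normrN ler_wpM2r// ger0_norm ?mulr_ge0 ?invr_ge0 ?(ltW l0) ?(ltW m0)//.
apply: (@le_trans _ _ ((e^-1 * (k.+1%:R ^+ 2)^-1) * (e^-1 * (k.+1%:R ^+ 2)^-1))).
  by rewrite ler_pM// invr_ge0 ltW.
rewrite mulrACA (_ : e^-1 * e^-1 = e ^- 2) -?expr2 ?exprVn//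
  ler_wpM2l ?invr_ge0 ?exprn_ge0 ?(ltW e0)//.
by rewrite -exprVn expr2 ler_piMl.
Qed.

Lemma G_dist e l m : 0 < e -> e <= 1 -> e - 1 <= l -> e - 1 <= m ->
  `|G l - G m| <= pi^-1 * (e ^- 2 * (pi ^+ 2 / 6) * `|l - m|).
Proof.
move=> e0 e1 el em; have l1 : -1 < l by lra.
have m1 : -1 < m by lra.
have cD : (green_sum l n - green_sum m n) @[n --> \oo] --> pi * G l - pi * G m.
  by apply: cvgB; exact: cvg_green_sum.
have cN : `|green_sum l n - green_sum m n| @[n --> \oo] --> `|pi * G l - pi * G m|.
  exact: cvg_norm cD.
rewrite -ler_pdivrMl ?invr_gt0 ?pi_gt0// invrK.
have -> : pi * `|G l - G m| = `|pi * G l - pi * G m|.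
  by rewrite -(mulrBr pi) (normrM pi) (ger0_norm (pi_ge0 R)).
rewrite -(cvg_lim _ cN)//; apply: limr_le.
  by apply/cvg_ex; eexists; exact: cN.
by apply: nearW => n; exact: green_sum_dist.
Qed.

Lemma continuous_G l : -1 < l -> {for l, continuous (@G R)}.
Proof.
(* The midpoint of -1 and l: any m within (l + 1) / 2 of l stays above it, so one margin e serves
   both points. *)
move=> l1; have l1' : -1 < (l - 1) / 2 by lra.
have [e [e0 e1 el]] := pole_margin _ l1'.
set C : R := pi^-1 * (e ^- 2 * (pi ^+ 2 / 6)).
have C0 : 0 <= C.
  by rewrite !mulr_ge0 ?invr_ge0 ?exprn_ge0 ?pi_ge0// ltW.
apply/cvgrPdist_le => d d0.
have r0 : 0 < Num.min ((l + 1) / 2) (d / (C + 1)).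
  by rewrite lt_min; apply/andP; split; apply: divr_gt0 => //; [lra|rewrite ltr_wpDl].
have /cvgrPdist_lt/(_ _ r0) nr : id m @[m --> l] --> l by exact: cvg_id.
near=> m.
have lm : `|l - m| < Num.min ((l + 1) / 2) (d / (C + 1)) by near: m.
move: lm; rewrite lt_min => /andP[lm1 lm2].
have em : e - 1 <= m by have := ler_norm (l - m); lra.
apply: (@le_trans _ _ (C * `|l - m|)).
  by rewrite /C -mulrA; apply: G_dist => //; lra.
apply: (@le_trans _ _ ((C + 1) * `|l - m|)).
  by rewrite ler_wpM2r// lerDl.
by rewrite -ler_pdivlMl ?ltr_wpDl// mulrC ltW.
Unshelve. all: by end_near. Qed.

End GreenSum.

(** * Upper bound *)

Section UpperBound.
Context {R : realType}.
Local Notation mu := (@lebesgue_measure R).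
Local Notation I := (`[0%R, 2 * pi]%classic : set R).

Lemma point_value_le_G (u g : R -> R) (l : R) : -1 < l ->
  is_primitive (2 * pi) u g -> u (2 * pi) = u 0 ->
  \int[mu]_(x in I) u x = 0 -> mu.-integrable I (EFin \o (fun x => g x ^+ 2)) ->
  u 0 ^+ 2 <=
  (\int[mu]_(x in I) (g x ^+ 2) + l * \int[mu]_(x in I) (u x ^+ 2)) * G l.
Proof.
move=> l1 ug up um g2.
set B := \int[mu]_(x in I) (g x ^+ 2); set A := \int[mu]_(x in I) (u x ^+ 2).
have c1 := cvg_point_value _ _ ug up um g2.
have cL : (pi^-1 * \sum_(k < n) fcos u k) ^+ 2 @[n --> \oo] --> u 0 ^+ 2.
  by rewrite expr2; under eq_fun do rewrite expr2; exact: cvgM.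
have cR : (B + l * A + 2 * `|l| * B * basel_tail n) * (pi^-1 * green_sum l n)
    @[n --> \oo] --> (B + l * A) * G l.
  apply: cvgM.
    rewrite -[X in _ --> X]addr0; apply: cvgD; first exact: cvg_cst.
    by rewrite -(mulr0 (2 * `|l| * B)); apply: cvgMr; exact: cvg_basel_tail.
  rewrite -[G l](mulKf (lt0r_neq0 (pi_gt0 R))).
  by apply: cvgMr; exact: cvg_green_sum.
rewrite -(cvg_lim _ cL)// -(cvg_lim _ cR)//; apply: ler_lim.
- by apply/cvg_ex; eexists; exact: cL.
- by apply/cvg_ex; eexists; exact: cR.
- by apply: nearW => n; exact: point_value_le.
Qed.

Lemma L2_integrable (g : R -> R) : L2_0_2pi g -> mu.-integrable I (EFin \o g).
Proof.
move=> [mg g2]; have c1 : continuous (fun _ : R => 1 : R) by exact: cst_continuous.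
have := integrableD_EFin _ _ _ _ (continuous_segment_integrable _ 0 (2 * pi) c1) g2.
apply: le_integrable => //; first exact/measurable_EFinP.
move=> x _ /=; rewrite lee_fin [X in _ <= X]ger0_norm ?addr_ge0 ?sqr_ge0//.
by have := normr_ge0 (g x); rewrite -(real_normK (num_real (g x))); nra.
Qed.

(** [point_value_le_G] is linear in the two energies, so the bounds for the real and imaginary parts
    add up to the one for u. *)
Lemma admissible_le (D : R) (ur ui : R -> R) (l : R) : -1 < l -> admissible D ur ui ->
  ur 0 ^+ 2 + ui 0 ^+ 2 <= (l + D) * G l.
Proof.
move=> l1 [gr [gi [[per [Lr [Li prim]]] [mr [mi [nu ng]]]]]].
have p0 := @period_ge0 R.
have pr : is_primitive (2 * pi) ur gr.
  by split; [exact: L2_integrable|move=> x /prim[]].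
have pi' : is_primitive (2 * pi) ui gi.
  by split; [exact: L2_integrable|move=> x /prim[]].
have [er ei] := per 0; rewrite add0r in er ei.
move: nu ng; rewrite !RintegralD//; [|exact: Lr.2|exact: Li.2
  |exact: integrable_primitive_sq pr|exact: integrable_primitive_sq pi'].
have := point_value_le_G _ _ _ l1 pr er mr Lr.2.
have := point_value_le_G _ _ _ l1 pi' ei mi Li.2.
move: (Rintegral _ _ _) (Rintegral _ _ _) (Rintegral _ _ _) (Rintegral _ _ _) => a b c d.
move=> h1 h2 e <-; apply: (le_trans (lerD h2 h1)).
have -> : a = 1 - c by lra.
by rewrite le_eqVlt; apply/orP; left; apply/eqP; ring.
Qed.

Lemma VV_le (D l : R) : -1 < l -> (VV D <= ((l + D) * G l)%:E)%E.
Proof.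
move=> l1; apply: ge_ereal_sup => _ [ur [ui [adm ->]]].
by rewrite lee_fin; exact: admissible_le.
Qed.

End UpperBound.

(** * Lower bound *)

Section LowerBound.
Context {R : realType}.
Local Notation mu := (@lebesgue_measure R).
Local Notation I := (`[0%R, 2 * pi]%classic : set R).
Implicit Types (al be : nat -> R) (D l e : R).

Lemma trigpoly_periodic al be n x :
  trigpoly al be n (x + 2 * pi) = trigpoly al be n x.
Proof.
apply: eq_bigr => k _.
rewrite mulrDr cosD sinD sin_nat_period cos_nat_period; ring.
Qed.

Lemma L2_continuous (g : R -> R) : continuous g -> L2_0_2pi g.
Proof.
move=> cg; split.
  by apply: measurable_funTS; exact: continuous_measurable_fun.
by apply: (@continuous_segment_integrable _ (fun x => g x ^+ 2)) => x; apply: cvgM; exact: cg.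
Qed.

(** The competitors are real cosine polynomials: sine terms would use up norm without changing the
    value at 0. *)
Lemma VV_ge_trigpoly D al n :
  pi * \sum_(k < n) al k ^+ 2 = 1 ->
  pi * \sum_(k < n) k.+1%:R ^+ 2 * al k ^+ 2 = D ->
  (((\sum_(k < n) al k) ^+ 2)%:E <= VV D)%E.
Proof.
move=> a1 aD; apply: ereal_sup_ubound.
have c0 : continuous (fun _ : R => 0 : R) by exact: cst_continuous.
pose u := trigpoly al (fun=> 0) n.
pose g := trigpoly (fun k => k.+1%:R * 0) (fun k => - (k.+1%:R * al k)) n.
have du (x : R) : is_derive x (1 : R) u (g x) by exact: is_derive_trigpoly.
have cg : continuous g by exact: continuous_trigpoly.
exists u, (fun=> 0); split; last first.
  congr EFin; rewrite expr0n addr0 /u /trigpoly; congr (_ ^+ 2); apply: eq_bigr => k _.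
  by rewrite mulr0 cos0 sin0; ring.
exists g, (fun=> 0); split.
  split; [|split; [|split]].
  - by move=> x; rewrite /u trigpoly_periodic.
  - exact: L2_continuous.
  - exact: L2_continuous.
  - move=> x /andP[x0 _]; rewrite (Rintegral_FTC u)//; split; first by ring.
    by rewrite Rintegral_cst// mul0r addr0.
have i0 : mu.-integrable I (EFin \o (fun _ : R => 0 ^+ 2)).
  exact/continuous_segment_integrable/cst_continuous.
split; first exact: Rintegral_trigpoly.
split; first by rewrite Rintegral_const mul0r.
split.
- under eq_Rintegral do rewrite expr0n addr0.
  rewrite Rintegral_trigpoly_sq -a1; congr (_ * _); apply: eq_bigr => k _.
  by rewrite expr0n addr0.
- under eq_Rintegral do rewrite expr0n addr0.
  rewrite Rintegral_trigpoly_sq -aD; congr (_ * _); apply: eq_bigr => k _; ring.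
Qed.

(** The derivative in l of [(l + D) * green_sum l n]. *)
Definition green_ratio D n l : R :=
  \sum_(k < n) (k.+1%:R ^+ 2 - D) * (l + k.+1%:R ^+ 2) ^- 2.

(* The stationarity condition green_ratio D n l = 0 says that the trigonometric
   polynomial with coefficients 1 / (l + k^2) has |u'|^2 = D |u|^2. *)
Lemma VV_ge_green_sum D l n : -1 < l -> green_ratio D n.+1 l = 0 ->
  (((l + D) * (pi^-1 * green_sum l n.+1))%:E <= VV D)%E.
Proof.
move=> l1 h; have p0 := pi_gt0 R.
have d0 k : 0 < l + k.+1%:R ^+ 2 by exact: green_den_gt0.
pose S2 : R := \sum_(k < n.+1) (l + k.+1%:R ^+ 2) ^- 2.
have S20 : 0 < S2.
  rewrite /S2 big_ord_recl ltr_pwDl ?invr_gt0 ?exprn_gt0//.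
  by apply: sumr_ge0 => k _; rewrite invr_ge0 exprn_ge0// ltW.
have S3E : \sum_(k < n.+1) k.+1%:R ^+ 2 * (l + k.+1%:R ^+ 2) ^- 2 = D * S2.
  apply/eqP; rewrite -subr_eq0 /S2 mulr_sumr -sumrB -[X in _ == X]h; apply/eqP.
  by apply: eq_bigr => k _; rewrite mulrBl.
(* Write 1 / (l + k^2) as (l + k^2) / (l + k^2)^2 and replace the k^2 part by [D * S2]. *)
have WE : green_sum l n.+1 = (l + D) * S2.
  rewrite mulrDl -S3E /S2 mulr_sumr -big_split/=; apply: eq_bigr => k _.
  rewrite -mulrDl; move: (l + _) (d0 k) => q q0.
  by field; rewrite lt0r_neq0.
(* c normalises the polynomial to L2 norm 1; by [S3E] its derivative then has squared norm D. *)
have [c c2] : exists c : R, c ^+ 2 = (pi * S2)^-1.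
  by exists (Num.sqrt (pi * S2))^-1; rewrite exprVn sqr_sqrtr// mulr_ge0 ?ltW.
have -> : (l + D) * (pi^-1 * green_sum l n.+1) =
    (\sum_(k < n.+1) c * (l + k.+1%:R ^+ 2)^-1) ^+ 2.
  rewrite -mulr_sumr exprMn c2 -/(green_sum _ _) WE.
  have e (p q s : R) : p != 0 -> s != 0 -> q * (p^-1 * (q * s)) = (p * s)^-1 * (q * s) ^+ 2.
    by move=> p1 s1; field; rewrite ?p1 ?s1.
  by rewrite e// lt0r_neq0.
apply: (VV_ge_trigpoly D (fun k => c * (l + k.+1%:R ^+ 2)^-1)).
  under eq_bigr do rewrite exprMn exprVn.
  by rewrite -mulr_sumr -/S2 c2 mulrCA mulVf// lt0r_neq0// mulr_gt0.
under eq_bigr do rewrite exprMn exprVn mulrCA.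
rewrite -mulr_sumr S3E c2.
have e (p s : R) : p != 0 -> s != 0 -> p * ((p * s)^-1 * (D * s)) = D.
  by move=> p1 s1; field; rewrite ?p1 ?s1.
by rewrite e// lt0r_neq0.
Qed.

Lemma continuous_green_ratio D n l : -1 < l -> {for l, continuous (green_ratio D n)}.
Proof.
move=> l1; elim: n => [|n IH].
  rewrite (_ : green_ratio D 0 = cst 0); first exact: cst_continuous.
  by apply/funext => x; rewrite /green_ratio big_ord0.
rewrite (_ : green_ratio D n.+1 = fun m => green_ratio D n m +
    (n.+1%:R ^+ 2 - D) * (m + n.+1%:R ^+ 2) ^- 2); last first.
  by apply/funext => x; rewrite /green_ratio big_ord_recr.
apply: cvgD; first exact: IH.
apply: cvgMr; apply: cvgV.
  by rewrite expf_neq0// lt0r_neq0// green_den_gt0.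
by apply: cvgM; (apply: cvgD; [exact: cvg_id|exact: cvg_cst]).
Qed.

Lemma ler_expV2 (x y : R) : 0 < x -> x <= y -> y ^- 2 <= x ^- 2.
Proof.
move=> x0 xy; have y0 := lt_le_trans x0 xy.
by rewrite lef_pV2 ?posrE ?exprn_gt0// ler_sqr// nnegrE ltW.
Qed.

(** Near the pole the frequency 1 dominates with (1 - D) / e^2. For k >= 2 one has e - 1 + k^2 >=
    k^2 / 2, so each other term is at most 4 / k^2 and they total at most 4 pi^2 / 6. *)
Lemma green_ratio_le0 D e n : 0 < e -> e <= 1 -> e * (D + 4 * (pi ^+ 2 / 6)) <= D - 1 ->
  1 <= D -> green_ratio D n.+1 (e - 1) <= 0.
Proof.
move=> e0 e1 eD D1; rewrite /green_ratio big_ord_recl/= expr1n subrK.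
have tail : \sum_(i < n) (i.+2%:R ^+ 2 - D) * (e - 1 + i.+2%:R ^+ 2) ^- 2 <= 4 * (pi ^+ 2 / 6).
  have := @basel_tail_ge0 R n.+1; rewrite /basel_tail big_ord_recl/= subr_ge0 => b.
  apply: (@le_trans _ _ (4 * \sum_(i < n) (i.+2%:R ^+ 2)^-1)); last first.
    by rewrite ler_wpM2l//; move: b; rewrite /bump/= expr1n invr1; lra.
  rewrite mulr_sumr; apply: ler_sum => i _.
  have k4 : 4 <= i.+2%:R ^+ 2 :> R by rewrite -natrX ler_nat (@leq_exp2r 2 i.+2 2).
  move: (i.+2%:R ^+ 2) k4 => q q4.
  apply: (@le_trans _ _ (q * (q / 2) ^- 2)).
    have h1 : 0 <= (e - 1 + q) ^- 2 by rewrite invr_ge0 sqr_ge0.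
    apply: (@le_trans _ _ (q * (e - 1 + q) ^- 2)); first by rewrite ler_wpM2r//; lra.
    by apply: ler_wpM2l; [lra|apply: ler_expV2; lra].
  rewrite le_eqVlt; apply/orP; left; apply/eqP; field; lra.
apply: (le_trans (lerD (lexx _) tail)).
have p0 : 0 <= pi ^+ 2 / 6 :> R by rewrite divr_ge0// sqr_ge0.
move: (pi ^+ 2 / 6) p0 eD => p p0 eD.
suff : (1 - D) * e ^- 2 <= - (D + 4 * p) by lra.
by rewrite -ler_pdivlMr ?invr_gt0 ?exprn_gt0// invrK; nra.
Qed.

Lemma green_ratio_nondecreasing D l (K m j : nat) : -1 < l -> D <= K%:R -> (K <= m)%N ->
  green_ratio D m l <= green_ratio D (m + j) l.
Proof.
move=> l1 DK Km; rewrite /green_ratio big_split_ord/= lerDl; apply: sumr_ge0 => i _.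
rewrite mulr_ge0 ?invr_ge0 ?sqr_ge0// subr_ge0 (le_trans DK)// -natrX ler_nat.
apply: (@leq_trans (m + i).+1); last by rewrite expnS expn1 leq_pmulr.
by rewrite (leq_trans Km)// (leq_trans (leq_addr _ _) (leqnSn _)).
Qed.

(** Only the first K terms can be negative, each at least -D / L^2. At L = (M + 1)^2 the single term
    of frequency M + 1 equals (L - D) / (4 L^2), which outweighs them once L >= D + 4 K D. Later
    terms are nonnegative, so the same L works for all n > M. *)
Lemma green_ratio_ge0 D : 1 <= D -> exists (L : R) (M : nat),
  1 <= L /\ forall n, (M <= n)%N -> 0 <= green_ratio D n L.
Proof.
move=> D1; pose K := (Num.trunc D).+1.
have DK : D <= K%:R by rewrite ltW// truncnS_gt.
pose M := maxn K (Num.trunc (D + 4 * K%:R * D)).+1.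
have MK : (K <= M)%N by exact: leq_maxl.
have MD : D + 4 * K%:R * D <= M.+1%:R.
  apply: ltW; apply: (lt_le_trans (truncnS_gt _)); rewrite ler_nat.
  by rewrite (leq_trans (leq_maxr K _)).
pose L : R := M.+1%:R ^+ 2.
have L1 : 1 <= L by exact: sqr_succ_ge1.
exists L, M.+1; split=> // n Mn.
have l1 : -1 < L by lra.
rewrite -(subnKC Mn); apply: le_trans (green_ratio_nondecreasing D L K _ _ l1 DK _); last first.
  exact: leq_trans MK _.
rewrite {1}/green_ratio big_ord_recr/= -/(green_ratio D M L) -/L.
have hM : - (K%:R * (D * L ^- 2)) <= green_ratio D M L.
  rewrite -(subnKC MK); apply: le_trans (green_ratio_nondecreasing D L K _ _ l1 DK _) => //.
  rewrite -[X in X%:R * _]card_ord -sum1_card natr_sum mulr_suml -sumrN.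
  apply: ler_sum => k _; rewrite mul1r -mulNr.
  have q1 := @sqr_succ_ge1 R k; move: (k.+1%:R ^+ 2) q1 => q q1.
  apply: (@le_trans _ _ (- D * (L + q) ^- 2)); last first.
    by rewrite ler_wpM2r ?invr_ge0 ?sqr_ge0//; lra.
  by rewrite !mulNr lerN2; apply: ler_wpM2l; [lra|apply: ler_expV2; lra].
have e : (L - D) * (L + L) ^- 2 = (L - D) / 4 * L ^- 2 by field; lra.
rewrite e; have L2 : 0 < L ^- 2 by rewrite invr_gt0 exprn_gt0//; lra.
have LD : 4 * K%:R * D <= L - D.
  rewrite lerBrDl (le_trans MD)// /L expr2 ler_peMr ?ler1n//.
move: (L ^- 2) L2 hM => w w0 hM; move: (K%:R * D) (mulrA 4 K%:R D) => *.
nra.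
Qed.

Lemma green_ratio_root D e L n : 0 < e -> e <= 1 ->  1 <= L ->
  green_ratio D n (e - 1) <= 0 -> 0 <= green_ratio D n L ->
  exists2 l, e - 1 <= l <= L & green_ratio D n l = 0.
Proof.
move=> e0 e1 L1 h1 h2.
have [|||l] := @IVT R (green_ratio D n) (e - 1) L 0.
- by lra.
- apply/continuous_in_subspaceT => x; rewrite inE/= in_itv/= => /andP[x1 _].
  by apply: continuous_green_ratio; lra.
- by rewrite ge_min h1/= le_max h2 orbT.
by rewrite in_itv/= => ? ?; exists l.
Qed.

End LowerBound.

(** * The minimum *)

Section Minimum.
Context {R : realType}.
Implicit Types (D l m e : R).

Lemma G_ge_pole m : -1 < m -> (m + 1)^-1 <= pi * G m.
Proof.
move=> m1; have := green_sum_le m 1 m1.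
by rewrite /green_sum big_ord_recl big_ord0 addr0 expr1n.
Qed.

(** The frequency 1 carries the whole singularity. For k >= 2, m + k^2 >= k^2 / 2, and the rest is
    at most 2 pi^2 / 6. With [G_ge_pole] this gives the behaviour of [G] at -1. *)
Lemma G_le_pole m : -1 < m -> pi * G m <= (m + 1)^-1 + pi ^+ 2 / 3.
Proof.
move=> m1; have cG := cvg_green_sum _ m1.
rewrite -(cvg_lim _ cG)//; apply: limr_le; first by apply/cvg_ex; eexists; exact: cG.
exists 1%N => // -[//|n] _ /=; rewrite /green_sum big_ord_recl/= expr1n lerD2l.
have := @basel_tail_ge0 R n.+1; rewrite /basel_tail big_ord_recl/= subr_ge0 => b.
apply: (@le_trans _ _ (2 * \sum_(i < n) (i.+2%:R ^+ 2)^-1)); last first.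
  by move: b; rewrite /bump/= expr1n invr1; lra.
rewrite mulr_sumr; apply: ler_sum => i _; rewrite /bump/=.
have k4 : 4 <= i.+2%:R ^+ 2 :> R by rewrite -natrX ler_nat (@leq_exp2r 2 i.+2 2).
move: (i.+2%:R ^+ 2) k4 => q q4.
have -> : 2 * q^-1 = (q / 2)^-1 by field; lra.
by rewrite lef_pV2 ?posrE; lra.
Qed.

Lemma near_pole_lt e : 0 < e -> \forall m \near (-1 : R)^'+, 0 < m + 1 < e.
Proof.
move=> e0; near=> m; apply/andP; split.
  by rewrite -ltrBlDr sub0r; near: m; exact: nbhs_right_gt.
by rewrite -[1]opprK; near: m; exact: nbhs_right_ltDr.
Unshelve. all: by end_near. Qed.

Lemma Phi_pole_gt1 D : 1 < D -> Phi D (-1) = +oo%E.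
Proof.
move=> D1; rewrite /Phi eqxx; apply/cvg_lim => //.
apply/cvgeryP/cvgryPge => A.
have p0 := pi_gt0 R.
have pA : 0 < pi * (`|A| + 1) by apply: mulr_gt0 => //; rewrite ltr_wpDl.
(* Closer to the pole than this, (D - 1) / (pi (m + 1)) exceeds |A| + 1. *)
have e0 : 0 < (D - 1) / (pi * (`|A| + 1)) by apply: divr_gt0; rewrite // subr_gt0.
near=> m; have : 0 < m + 1 < (D - 1) / (pi * (`|A| + 1)).
  by near: m; exact: near_pole_lt.
rewrite (ltr_pdivlMr _ _ pA) => /andP[m1 mA].
have mm : -1 < m by lra.
have := G_ge_pole _ mm; rewrite -ler_pdivrMl// => gm.
apply: (@le_trans _ _ (`|A| + 1)); first by have := ler_norm A; lra.
have G0 : 0 <= G m.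
  by apply: le_trans gm; apply: mulr_ge0; rewrite invr_ge0 ltW.
apply: (@le_trans _ _ ((D - 1) * G m)); last by rewrite ler_wpM2r//; lra.
apply: (@le_trans _ _ ((D - 1) * (pi^-1 * (m + 1)^-1))); last by rewrite ler_wpM2l//; lra.
rewrite -invfM ler_pdivlMr ?mulr_gt0//; apply: le_trans (ltW mA).
by rewrite le_eqVlt; apply/orP; left; apply/eqP; ring.
Unshelve. all: by end_near. Qed.

(** For D = 1 the factor m + 1 cancels the pole: pi (m + 1) G(m) lies between 1 and 1 + (m + 1) pi^2
    / 3. *)
Lemma Phi_pole_1 : Phi 1 (-1) = (pi^-1)%:E :> \bar R.
Proof.
rewrite /Phi eqxx; apply/cvg_lim => //; apply/cvg_EFin; first exact: nearW.
have p0 := pi_gt0 R.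
apply/cvgrPdist_le => d d0.
have e0 : 0 < pi * d / (pi ^+ 2 / 3) by rewrite divr_gt0 ?divr_gt0 ?mulr_gt0 ?exprn_gt0.
near=> m; have /andP[m1 me] : 0 < m + 1 < pi * d / (pi ^+ 2 / 3).
  by near: m; exact: near_pole_lt.
have mm : -1 < m by lra.
have := G_ge_pole _ mm; have := G_le_pole _ mm => h1 h2.
rewrite -(ler_pM2l p0) -{1}(ger0_norm (ltW p0)) -normrM mulrBr mulfV ?lt0r_neq0//.
rewrite mulrCA ler_norml; apply/andP; split; last first.
  have : (m + 1) * (m + 1)^-1 <= (m + 1) * (pi * G m) by rewrite ler_wpM2l// ltW.
  by rewrite mulfV ?lt0r_neq0//; have := mulr_gt0 p0 d0; lra.
have : (m + 1) * (pi * G m) <= (m + 1) * ((m + 1)^-1 + pi ^+ 2 / 3).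
  by rewrite ler_wpM2l// ltW.
rewrite mulrDr mulfV ?lt0r_neq0//.
by move: me; rewrite ltr_pdivlMr ?divr_gt0 ?exprn_gt0//; lra.
Unshelve. all: by end_near. Qed.

Lemma PhiE D l : -1 < l -> Phi D l = ((l + D) * G l)%:E.
Proof. by move=> l1; rewrite /Phi gt_eqF. Qed.

Lemma VV_1 : VV 1 = (pi^-1)%:E :> \bar R.
Proof.
have p0 := pi_gt0 R.
apply/eqP; rewrite eq_le; apply/andP; split.
  apply/lee_addgt0Pr => d d0.
  (* With l + 1 = 3 d / pi, the excess (l + 1) pi / 3 over 1 / pi allowed by [G_le_pole] is exactly
     d. *)
  have e0 : 0 < 3 * d / pi by rewrite divr_gt0 ?mulr_gt0.
  have m1 : -1 < 3 * d / pi - 1 by lra.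
  apply: (le_trans (VV_le 1 _ m1)); rewrite -EFinD lee_fin.
  have := G_le_pole _ m1; rewrite !subrK => h.
  rewrite -(ler_pM2l p0) mulrCA (le_trans (ler_wpM2l (ltW e0) h))//.
  rewrite mulrDr mulfV ?lt0r_neq0// mulrDr mulfV ?lt0r_neq0//.
  rewrite lerD2l le_eqVlt; apply/orP; left; apply/eqP.
  by move: (pi) p0 => p p0; field; rewrite lt0r_neq0.
have [c c2] : exists c : R, c ^+ 2 = pi^-1.
  by exists (Num.sqrt pi^-1); rewrite sqr_sqrtr// invr_ge0 ltW.
have := VV_ge_trigpoly 1 (fun=> c) 1; rewrite !big_ord1/= expr1n mul1r c2.
by apply; rewrite mulfV// lt0r_neq0.
Qed.

Lemma VV_eq_minimum D : 1 < D ->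
  exists2 l0 : R, -1 < l0 & VV D = ((l0 + D) * G l0)%:E.
Proof.
move=> D1; have p0 := pi_gt0 R; have D1' := ltW D1.
have [L [M [L1 hL]]] := green_ratio_ge0 _ D1'.
have P0 : 0 <= pi ^+ 2 / 6 :> R by rewrite divr_ge0// sqr_ge0.
set q := D + 4 * (pi ^+ 2 / 6); have q0 : D <= q by rewrite lerDl mulr_ge0.
(* The largest margin accepted by [green_ratio_le0]; q >= D makes it at most 1. *)
pose e := (D - 1) / q.
have e0 : 0 < e by rewrite divr_gt0//; lra.
have e1 : e <= 1 by rewrite ler_pdivrMr; lra.
have eD : e * q <= D - 1 by rewrite divfK//; apply: lt0r_neq0; lra.
pose f l : R := (l + D) * G l.
have cf : {within `[e - 1, L], continuous f}.
  apply/continuous_in_subspaceT => x; rewrite inE/= in_itv/= => /andP[x1 _].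
  apply: cvgM; last by apply: continuous_G; lra.
  by apply: cvgD; [exact: cvg_id|exact: cvg_cst].
have eL : e - 1 <= L by lra.
have [l0] := EVT_min eL cf; rewrite in_itv/= => /andP[l0e l0L] l0min.
have l01 : -1 < l0 by lra.
exists l0 => //; apply/eqP; rewrite eq_le VV_le//=.
(* Bounds the factor (l + D) / (pi e) of the truncation error for all l <= L, so the error does not
   depend on where the root lies. *)
pose C : R := (L + D) * (pi^-1 * e^-1).
have low n : (M <= n)%N -> ((f l0 - C * basel_tail n.+1)%:E <= VV D)%E.
  move=> Mn.
  have [l /andP[le lL] hl] := green_ratio_root D e L n.+1 e0 e1 L1
    (green_ratio_le0 _ _ _ e0 e1 eD D1') (hL _ (leqW Mn)).
  have l1 : -1 < l by lra.
  apply: le_trans (VV_ge_green_sum _ _ _ l1 hl); rewrite lee_fin.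
  have : f l0 <= f l by apply: l0min; rewrite in_itv/= le lL.
  have := G_le_green_sum _ _ n.+1 e0 e1 le; rewrite -ler_pdivlMl// mulrDr => hG.
  move=> fl; rewrite lerBlDr (le_trans fl)// /f.
  have lD : 0 <= l + D by lra.
  apply: (le_trans (ler_wpM2l lD hG)).
  rewrite mulrDr lerD2l (mulrA pi^-1) mulrA ler_wpM2r ?basel_tail_ge0//.
  by apply: ler_wpM2r; [rewrite mulr_ge0// invr_ge0 ltW|lra].
(* The supremum lies between two reals, hence the final limit can be taken in R. *)
have [v vE] : exists v : R, VV D = v%:E.
  have := VV_le D l0 l01; have := low M (leqnn M).
  by case: (VV D) => [v _ _|//|//]; exists v.
rewrite vE lee_fin.
have cC : f l0 - C * basel_tail n.+1 @[n --> \oo] --> f l0.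
  rewrite -[X in _ --> X]subr0 -[X in _ - X](mulr0 C); apply: cvgB; first exact: cvg_cst.
  by apply: cvgMr; rewrite (cvg_shiftS (@basel_tail R)); exact: cvg_basel_tail.
rewrite -/(f l0) -(cvg_lim _ cC)//; apply: limr_le.
  by apply/cvg_ex; eexists; exact: cC.
by exists M => // n /= /low; rewrite vE lee_fin.
Qed.

End Minimum.

Theorem theorem2p2 (R : realType) (D : R) (hD : 1 <= D) :
  exists2 l0 : R, -1 <= l0 &
    VV D = Phi D l0 /\ (forall l : R, -1 <= l -> (VV D <= Phi D l)%E).
Proof.
move: hD; rewrite le_eqVlt => /predU1P[<-|D1].
  exists (-1) => //; rewrite Phi_pole_1 VV_1; split=> // l.
  rewrite le_eqVlt => /predU1P[<-|l1]; first by rewrite Phi_pole_1.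
  by rewrite PhiE// -VV_1 VV_le.
have [l0 l01 E] := VV_eq_minimum _ D1.
exists l0; first exact: ltW.
split; first by rewrite PhiE.
move=> l; rewrite le_eqVlt => /predU1P[<-|l1].
  by rewrite Phi_pole_gt1// leey.
by rewrite PhiE// VV_le.
Qed.
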